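(* For the translation-invariant model described in the context, if $p\ne\frac12$, then for every measurable set $A\subseteq\{-1,1\}^{\mathbb{Z}}$ and every $v\in\mathbb{Z}$, $$\big|\mathbf{P}[X_k\in A|X_0,Y_1,\ldots,Y_{k-1},Y_k^{<v}]-\mathbf{P}[X_k\in A|Y_1,\ldots,Y_{k-1},Y_k^{<v}]\big|\xrightarrow{k\to\infty}0\quad\text{in }L^1,$$ where $Y_k^{<v}:=\{Y_k^w:w<v\}$.
   Context: Model. $(X_k,Y_k)_{k\in\mathbb{Z}}$ is a stationary process with $X_k=(X_k^v)_{v\in\mathbb{Z}}\in\{-1,1\}^{\mathbb{Z}}$ and $Y_k=(Y_k^v)_{v\in\mathbb{Z}}\in\{-1,1\}^{\mathbb{Z}}$ such that: (1) $(X_k)_{k\in\mathbb{Z}}$ is a stationary Markov chain whose transition kernel $P$ has the local form $P(x,dz)=\prod_{v\in\mathbb{Z}}P^v(x,dz^v)$, where $P^v(x,\cdot)$ is a probability on $\{-1,1\}$ that depends only on $x^w$ for $|w-v|\le 1$; as a standing assumption, this chain admits a unique invariant measure. (2) The observations are $Y_k^v=X_k^v\xi_k^v$, where $(\xi_k^v)_{k,v\in\mathbb{Z}}$ are i.i.d. $\{-1,1\}$-valued, independent of $X$, with $\mathbf{P}[\xi_k^v=-1]=p$, $p\in[0,1]$. (3) The model is translation-invariant: the local kernels do not depend on the site up to translation, i.e. $P^{v}(x,\cdot)=P^{0}(\theta_v x,\cdot)$ for all $v\in\mathbb{Z}$ with $(\theta_vx)^u:=x^{u+v}$, and $$(X_k^v,Y_k^v)_{k,v\in\mathbb{Z}}\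 \overset{\mathrm{law}}{=}\ (X_{k+\ell}^{v+w},Y_{k+\ell}^{v+w})_{k,v\in\mathbb{Z}}\quad\text{for all }\ell,w\in\mathbb{Z}.$$ *)

(* Defs.v *)
From HB Require Import structures.
From mathcomp Require Import all_boot all_order all_algebra.
From mathcomp Require Import all_classical all_reals all_analysis.
From mathcomp Require Import measurable_realfun.

Set Implicit Arguments.
Unset Strict Implicit.
Unset Printing Implicit Defensive.
Import Order.TTheory GRing.Theory Num.Theory.
Import numFieldNormedType.Exports.

Local Open Scope classical_set_scope.
Local Open Scope ring_scope.

(* The state space {-1,1} is bool with its discrete sigma-algebra; [true]
   stands for -1 and [false] for 1. *)
Notation spin := bool.
Definition spin_val (s : spin) : int := (-1) ^+ s.

Definition cylinders (I : Type) d (T : measurableType d) : set (set (I -> T)) :=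
  [set E | exists i, exists2 B, measurable B & E = [set x | B (x i)]].

(* I -> T with the product sigma-algebra. *)
Definition field_space (I : Type) d (T : measurableType d) :=
  g_sigma_algebraType (@cylinders I d T).

Notation config := (field_space int spin).

Definition sigma_gen (Omega : Type) d (T : measurableType d)
    (F : set (Omega -> T)) : set (set Omega) :=
  <<s [set E | exists2 f, F f & exists2 B, measurable B & E = f @^-1` B] >>.

(* f is a version of the conditional probability Pr[E | G]; versions exist by
   [CondProb.cond_prob_exists] below and are a.s. unique. *)
Definition cond_prob d (Omega : measurableType d) (R : realType)
    (Pr : probability Omega R) (G : set (set Omega)) (E : set Omega)
    (f : Omega -> R) : Prop :=
  [/\ forall B, measurable B -> G (f @^-1` B),
      Pr.-integrable setT (EFin \o f)
    & forall B, G B -> (\int[Pr]_(o in B) (f o)%:E = Pr (E `&` B))%E].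

Module CondProb.
Section cond_prob_exists.
Context d (Omega : measurableType d) (R : realType)
  (Pr : probability Omega R) (C : set (set Omega)) (E : set Omega).
Hypotheses (mC : C `<=` measurable) (mE : measurable E).

Let S := g_sigma_algebraType C.

Let mS (B : set Omega) : <<s C >> B -> measurable B.
Proof. by apply: smallest_sub => //; exact: sigma_algebra_measurable. Qed.

Let toS (o : Omega) : S := o.
Let mtoS : measurable_fun setT toS.
Proof. by move=> _ B /mS mB; rewrite setTI. Qed.
HB.instance Definition _ := isMeasurableFun.Build _ _ _ _ toS mtoS.

Let nu (B : set S) : \bar R := Pr (E `&` B).
Let nu0 : nu set0 = 0%E.
Proof. by rewrite /nu setI0 measure0. Qed.
Let nu_ge0 B : (0 <= nu B)%E.
Proof. exact: measure_ge0. Qed.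
Let nu_sigma_additive : semi_sigma_additive nu.
Proof.
move=> F mF tF mUF; rewrite /nu setI_bigcupr.
apply: measure_semi_sigma_additive.
- by move=> n; apply: measurableI => //; exact: mS (mF n).
- exact: trivIset_setIl.
- by rewrite -setI_bigcupr; apply: measurableI => //; exact: mS mUF.
Qed.
HB.instance Definition _ := isMeasure.Build _ _ _ nu
  nu0 nu_ge0 nu_sigma_additive.
Let nu_fin : fin_num_fun nu.
Proof.
by move=> B mB; rewrite /nu fin_num_measure//; apply: measurableI => //; exact: mS mB.
Qed.
HB.instance Definition _ := Measure_isFinite.Build _ _ _ nu nu_fin.

Lemma cond_prob_exists : exists f, cond_prob Pr <<s C>> E f.
Proof.
have nuP : nu `<< distribution Pr toS.
  apply/null_content_dominatesP => B mB PB0.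
  apply/eqP; rewrite eq_le measure_ge0 andbT -PB0.
  rewrite /distribution /pushforward /nu le_measure ?inE//.
    by apply: measurableI => //; exact: mS mB.
  exact: mS mB.
have [h [h0 hfin hint hE]] := radon_nikodym_sigma_finite nuP.
have hE' : h = EFin \o (fine \o h) by apply/funext => o /=; rewrite fineK.
have mh : measurable_fun setT (fine \o h).
  apply/measurable_EFinP; rewrite -hE'; exact: measurable_int hint.
have hint' : Pr.-integrable setT h.
  apply/integrableP; split.
    exact: measurableT_comp (measurable_int _ hint) mtoS.
  have /integrableP[_] := hint; apply: le_lt_trans.
  rewrite ge0_integral_pushforward//.
  apply: measurableT_comp => //; exact: measurable_int hint.
exists (fine \o h); split.
- move=> B mB; have := mh measurableT B mB; by rewrite setTI.
- by rewrite -hE'.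
- move=> B sB; transitivity (nu B) => [|//]; rewrite [RHS](hE B sB).
  rewrite ge0_integral_pushforward//.
    by apply: eq_integral => o _; rewrite /= fineK.
  apply: measurable_funTS; exact: measurable_int hint.
Qed.
End cond_prob_exists.
End CondProb.

(* The joint law of (X_k^v, Y_k^v)_{k,v} is unchanged by the shift (l, w). *)
Definition shift_invariant d (Omega : measurableType d) (R : realType)
    (Pr : probability Omega R) (X Y : int -> int -> {RV Pr >-> spin})
    (l w : int) : Prop :=
  forall B : set (field_space (int * int) (spin * spin)%type), measurable B ->
    Pr [set o | B (fun kv => (X kv.1 kv.2 o, Y kv.1 kv.2 o))] =
    Pr [set o | B (fun kv => (X (kv.1 + l) (kv.2 + w) o,
                              Y (kv.1 + l) (kv.2 + w) o))].

Definition nearest_neighbour (R : realType)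
    (Ploc : int -> config -> probability spin R) : Prop :=
  forall (v : int) (x x' : config),
    (forall w : int, `|w - v| <= 1 -> x w = x' w) ->
  forall B, Ploc v x B = Ploc v x' B.

(* P x is the product measure of the Ploc v x over all sites v: a probability
   on the product sigma-algebra is determined by its values on finite
   rectangles. *)
Definition product_kernel (R : realType)
    (Ploc : int -> config -> probability spin R)
    (P : R.-pker config ~> config) : Prop :=
  forall (x : config) (V : seq int) (B : int -> set spin), uniq V ->
    (P x [set z | forall v, v \in V -> B v (z v)] =
     \big[*%E/1%E]_(v <- V) Ploc v x (B v))%E.

Definition invariant_measure (R : realType) (P : R.-pker config ~> config)
    (mu : probability config R) : Prop :=
  forall A, measurable A -> (mu A = \int[mu]_x P x A)%E.

Definition unique_invariant_measure (R : realType)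
    (P : R.-pker config ~> config) : Prop :=
  exists2 mu, invariant_measure P mu
    & forall nu, invariant_measure P nu ->
      forall A, measurable A -> nu A = mu A.

Definition markov_chain d (Omega : measurableType d) (R : realType)
    (Pr : probability Omega R) (P : R.-pker config ~> config)
    (X : int -> int -> {RV Pr >-> spin}) : Prop :=
  forall (k : int) (A : set config), measurable A ->
    cond_prob Pr
      (sigma_gen [set (X j v : Omega -> spin) | j in [set j | j <= k]
                                              & v in setT])
      [set o | A (fun v => X (k + 1) v o)]
      (fun o => fine (P (fun v => X k v o) A)).

Definition mutually_independent d (Omega : measurableType d) (R : realType)
    (Pr : probability Omega R) (I : choiceType) d' (T : measurableType d')
    (Z : I -> {RV Pr >-> T}) : Prop :=
  forall (J : seq I) (B : I -> set T), uniq J ->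
    (forall i, measurable (B i)) ->
    (Pr [set o | forall i, i \in J -> B i (Z i o)] =
     \big[*%E/1%E]_(i <- J) Pr (Z i @^-1` B i))%E.

Definition independent_fields d (Omega : measurableType d) (R : realType)
    (Pr : probability Omega R) (X Z : int -> int -> {RV Pr >-> spin}) : Prop :=
  forall B C : set (field_space (int * int) spin),
    measurable B -> measurable C ->
    let EX := [set o | B (fun kv => X kv.1 kv.2 o)] in
    let EZ := [set o | C (fun kv => Z kv.1 kv.2 o)] in
    (Pr (EX `&` EZ) = Pr EX * Pr EZ)%E.

(* First index: time k; second index: site v. *)
Record model d (Omega : measurableType d) (R : realType)
    (Pr : probability Omega R)
    (Ploc : int -> config -> probability spin R)
    (P : R.-pker config ~> config) (p : R)
    (X Y xi : int -> int -> {RV Pr >-> spin}) : Prop := {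
  model_stationary : forall l, shift_invariant X Y l 0;
  model_local : nearest_neighbour Ploc;
  model_product : product_kernel Ploc P;
  model_markov : markov_chain P X;
  model_unique : unique_invariant_measure P;
  model_p : 0 <= p <= 1;
  model_obs : forall k v o,
    spin_val (Y k v o) = spin_val (X k v o) * spin_val (xi k v o);
  model_noise_law : forall k v, Pr [set o | spin_val (xi k v o) = -1] = p%:E;
  model_noise_indep : mutually_independent (fun kv => xi kv.1 kv.2);
  model_noise_signal : independent_fields X xi
}.

Definition site_shift (v : int) (x : config) : config := fun u => x (u + v).

Record translation_invariant d (Omega : measurableType d) (R : realType)
    (Pr : probability Omega R) (Ploc : int -> config -> probability spin R)
    (X Y : int -> int -> {RV Pr >-> spin}) : Prop := {
  ti_kernel : forall v x B, Ploc v x B = Ploc 0 (site_shift v x) B;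
  ti_law : forall l w, shift_invariant X Y l w
}.

(* X_0, the whole configuration at time 0. *)
Definition initial_vars d (Omega : measurableType d) (R : realType)
    (Pr : probability Omega R) (X : int -> int -> {RV Pr >-> spin}) :
    set (Omega -> spin) :=
  [set (X 0 w : Omega -> spin) | w in setT].

(* Y_1, ..., Y_{k-1} (all sites) and Y_k^w for w < v. *)
Definition obs_vars d (Omega : measurableType d) (R : realType)
    (Pr : probability Omega R) (Y : int -> int -> {RV Pr >-> spin})
    (k v : int) : set (Omega -> spin) :=
  [set (Y j w : Omega -> spin) | j in [set j | 1 <= j < k] & w in setT] `|`
  [set (Y k w : Omega -> spin) | w in [set w | w < v]].

(* Main.v *)
Require Import Defs.
From HB Require Import structures.
From mathcomp Require Import all_boot all_order all_algebra.
From mathcomp Require Import all_classical all_reals all_analysis.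
From mathcomp Require Import ring lra zify.

(* Cut the sites into blocks of length L.  For a window of n blocks the mutual
   information between X_0 and Y_1, ..., Y_k is at most the entropy of X_0 in the window, hence O(n), whatever k is.  Expanding it
   by the chain rule in lexicographic order and letting n tend to infinity, the
   sum over j of the conditional mutual informations
     I(Y_j^{block}; X_0 | Y_1, ..., Y_{j-1}, Y_j^{left of the block})
   is finite, so its terms tend to 0.  A Pinsker-type inequality turns this into an
   L1 statement about the conditional law of a block of Y_j; as p <> 1/2 the noise
   channel is invertible, which transfers it to the block of X_j jointly with the
   block of Y_j, and Bayes' rule adds the coordinates of Y_j inside the block to
   the conditioning.  All this concerns finite windows, whose sigma-algebras are
   dense in those of the theorem; finally A is approximated by a window event,
   uniformly in time by stationarity. *)

Set Implicit Arguments.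
Unset Strict Implicit.
Unset Printing Implicit Defensive.
Import Order.TTheory GRing.Theory Num.Theory.
Import numFieldNormedType.Exports.

Local Open Scope classical_set_scope.
Local Open Scope ring_scope.

(** * Finite-valued random variables and entropy *)

(** The configuration [X_0] may have infinite entropy, so the information it carries can only be
    bounded per block, and translation invariance makes all blocks alike. The chain rule is applied
    to the observations rather than to the signal, because its terms have to condition on earlier
    observations only; the signal is recovered afterwards through the channel. Choices are made in
    the order: accuracy, block radius [N], time, window radius [m]. The block is [[-N, N]] with [N]
    so large that it contains [v] and nearly determines [A]; the loss in inverting the channel
    depends on [N] but not on time. The window may depend on time: for each fixed time both
    conditional probabilities are approximated in L1 by functions of a finite window. Arbitrary
    approximating functions suffice, which takes the place of martingale convergence and turns every
    comparison into a finite sum. *)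

Section finite_valued.
Context d (Omega : measurableType d).

(** Measurability for the discrete sigma-algebra on [T]; quantifying over all sets [B] lets pairs,
    tuples and finite functions be values without a measurable structure of their own. *)
Definition frv (T : finType) (U : Omega -> T) :=
  forall B : set T, measurable (U @^-1` B).

Lemma frvP (T : finType) (U : Omega -> T) :
  (forall t, measurable (U @^-1` [set t])) -> frv U.
Proof.
move=> mU B.
have -> : U @^-1` B = \bigcup_(t in B) (U @^-1` [set t]).
  by apply/seteqP; split => [x Bx|x [t Bt /= ->]] //; exists (U x).
by apply: fin_bigcup_measurable => // ; exact: finite_finset.
Qed.

Lemma frv_comp (T T' : finType) (f : T -> T') (U : Omega -> T) :
  frv U -> frv (f \o U).
Proof. by move=> mU B; exact: (mU (f @^-1` B)). Qed.

Lemma frv_cst (T : finType) (t : T) : frv (fun=> t).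
Proof. by move=> B; rewrite preimage_cst; case: ifP. Qed.

Lemma frv_pair (T T' : finType) (U : Omega -> T) (V : Omega -> T') :
  frv U -> frv V -> frv (fun o => (U o, V o)).
Proof.
move=> mU mV; apply: frvP => -[u v].
have -> : (fun o => (U o, V o)) @^-1` [set (u, v)] =
    U @^-1` [set u] `&` V @^-1` [set v].
  by apply/seteqP; split => o /= => [[-> ->]|[-> ->]].
by apply: measurableI; [exact: mU|exact: mV].
Qed.

Lemma frv_ffun (I T : finType) (U : I -> Omega -> T) :
  (forall i, frv (U i)) -> frv (fun o => [ffun i => U i o]).
Proof.
move=> mU; apply: frvP => t.
have -> : (fun o => [ffun i => U i o]) @^-1` [set t] =
    \bigcap_(i in setT) (U i @^-1` [set t i]).
  apply/seteqP; split => o /= => [<- i _|h]; first by rewrite ffunE.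
  by apply/ffunP => i; rewrite ffunE; exact: h.
apply: fin_bigcap_measurable; [exact: finite_finset|by move=> i _; exact: mU].
Qed.

Lemma frv_pred (E : set Omega) : measurable E -> frv (fun o => `[< E o >]).
Proof.
move=> mE; apply: frvP => b.
have -> : (fun o => `[< E o >]) @^-1` [set b] = if b then E else ~` E.
  by case: b; apply/seteqP; split => o /=; case: (asboolP (E o)).
by case: b => //; exact: measurableC.
Qed.

End finite_valued.

Section law.
Context d (Omega : measurableType d) (R : realType) (Pr : probability Omega R).

Definition pr (E : set Omega) : R := fine (Pr E).

Lemma prE E : measurable E -> Pr E = (pr E)%:E.
Proof. by move=> mE; rewrite /pr fineK// fin_num_measure. Qed.

Lemma pr_ge0 E : 0 <= pr E.
Proof. by rewrite /pr fine_ge0. Qed.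

Lemma prT : pr setT = 1.
Proof. by rewrite /pr probability_setT. Qed.

Lemma le_pr E F : measurable E -> measurable F -> E `<=` F -> pr E <= pr F.
Proof.
by move=> mE mF EF; rewrite -lee_fin -!prE// le_measure// inE.
Qed.

Lemma prU E F : measurable E -> measurable F -> E `&` F = set0 ->
  pr (E `|` F) = pr E + pr F.
Proof.
move=> mE mF EF; apply/EFin_inj; rewrite EFinD -!prE//; last exact: measurableU.
exact: measureU.
Qed.

Definition law (T : finType) (U : Omega -> T) (t : T) : R := pr (U @^-1` [set t]).

Lemma law_ge0 (T : finType) (U : Omega -> T) t : 0 <= law U t.
Proof. exact: pr_ge0. Qed.

Lemma pr_frv (T : finType) (U : Omega -> T) (P : pred T) : frv U ->
  pr [set o | P (U o)] = \sum_(t | P t) law U t.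
Proof.
move=> mU; suff H r : uniq r -> pr [set o | U o \in r] = \sum_(t <- r) law U t.
  rewrite -[RHS]big_filter -H ?filter_uniq ?index_enum_uniq//; congr pr.
  by apply/seteqP; split => o /=; rewrite mem_filter mem_index_enum andbT.
elim: r => [_|t r IH /= /andP[tr ur]].
  rewrite big_nil /pr (_ : [set _ | _] = set0) ?measure0//.
  by apply/seteqP; split.
rewrite big_cons -IH// -prU; [|exact: mU|exact: (mU [set x | x \in r])|].
  congr pr; apply/seteqP; split => o /=.
    by rewrite inE => /orP[/eqP ->|]; [left|right].
  by rewrite inE => -[->|->]; rewrite ?eqxx ?orbT.
by apply/seteqP; split => // o /= [->]; rewrite (negbTE tr).
Qed.

Lemma law_comp (T T' : finType) (f : T -> T') (U : Omega -> T) s : frv U ->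
  law (f \o U) s = \sum_(t | f t == s) law U t.
Proof.
move=> mU; rewrite -pr_frv// /law; congr pr.
by apply/seteqP; split => o /= => [->|/eqP].
Qed.

Lemma law_expect (T T' : finType) (f : T -> T') (U : Omega -> T) (F : T' -> R) :
  frv U -> \sum_s law (f \o U) s * F s = \sum_t law U t * F (f t).
Proof.
move=> mU; rewrite [RHS](partition_big f predT)//=; apply: eq_bigr => s _.
rewrite law_comp// mulr_suml; apply: eq_bigr => t /eqP ts.
by rewrite ts.
Qed.

Lemma law_sum1 (T : finType) (U : Omega -> T) : frv U -> \sum_t law U t = 1.
Proof.
by move=> mU; rewrite -(pr_frv predT)// (_ : [set _ | _] = setT) ?prT//; apply/seteqP.
Qed.

Lemma law_le_comp (T T' : finType) (f : T -> T') (U : Omega -> T) t : frv U ->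
  law U t <= law (f \o U) (f t).
Proof.
move=> mU; rewrite law_comp// (bigD1 t)//= lerDl.
by apply: sumr_ge0 => *; exact: law_ge0.
Qed.

Definition entropy (T : finType) (U : Omega -> T) : R :=
  - \sum_t law U t * ln (law U t).

Lemma entropy_comp (T T' : finType) (f : T -> T') (U : Omega -> T) : frv U ->
  entropy (f \o U) = - \sum_t law U t * ln (law (f \o U) (f t)).
Proof.
by move=> mU; rewrite /entropy (law_expect f (fun s => ln (law (f \o U) s))).
Qed.

(** An atom of [U] lies inside an atom of [f \o U], so passing to the image can only increase the
    logarithms. *)
Lemma le_entropy_comp (T T' : finType) (f : T -> T') (U : Omega -> T) : frv U ->
  entropy (f \o U) <= entropy U.
Proof.
move=> mU; rewrite entropy_comp// lerN2; apply: ler_sum => t _.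
have := law_ge0 U t; rewrite le_eqVlt => /predU1P[<-|p0]; first by rewrite !mul0r.
have h := law_le_comp f t mU.
by rewrite ler_pM2l// ler_ln// posrE// (lt_le_trans p0).
Qed.

(** Values outside the range of [V] need a default, [U w]; a point [w] exists because an empty
    [Omega] would have mass 0. *)
Lemma factor_through (T T' : finType) (U : Omega -> T') (V : Omega -> T) :
  (forall o o', V o = V o' -> U o = U o') -> exists f, U = f \o V.
Proof.
move=> h.
have [w _] : (setT : set Omega) !=set0.
  apply/set0P/eqP => T0; have := probability_setT Pr.
  by rewrite T0 measure0 => /esym/eqP; rewrite onee_eq0.
exists (fun t => if pselect (exists o, V o = t) is left e
  then U (projT1 (cid e)) else U w).
apply/funext => o /=; case: pselect => [e|]; last by case; exists o.
by apply: h; rewrite (projT2 (cid e)).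
Qed.

(** Phrased by determination instead of an explicit map, so that vectors listing the same
    coordinates differently can be compared in both directions. *)
Lemma le_entropy (T T' : finType) (U : Omega -> T') (V : Omega -> T) : frv V ->
  (forall o o', V o = V o' -> U o = U o') -> entropy U <= entropy V.
Proof. by move=> mV /factor_through[f ->]; exact: le_entropy_comp. Qed.

(** Each summand [- p * ln p] is at most 1, from [ln x < x] at [x = p^-1]. The bound serves as a
    finite constant per block. *)
Lemma entropy_le_card (T : finType) (U : Omega -> T) : entropy U <= #|T|%:R.
Proof.
rewrite /entropy -sumrN -sum1_card natr_sum; apply: ler_sum => t _.
have := law_ge0 U t; rewrite le_eqVlt => /predU1P[<-|p0]; first by rewrite mul0r oppr0.
rewrite -mulrN -lnV ?posrE// -(divff (lt0r_neq0 p0)) ler_pM2l//.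
by apply: ltW; apply: ln_sublinear; rewrite invr_gt0.
Qed.

Lemma entropy_unit : entropy (fun=> tt) = 0.
Proof.
rewrite /entropy (bigD1 tt)//= big1 => [|[]//].
by rewrite addr0 /law preimage_cst ifT ?inE// prT ln1 mulr0 oppr0.
Qed.

Lemma entropy_ge0 (T : finType) (U : Omega -> T) : frv U -> 0 <= entropy U.
Proof. by move=> mU; rewrite -entropy_unit; exact: le_entropy. Qed.

End law.

(** * Conditional mutual information *)

Section divergence.
Context (R : realType).
Implicit Types p q : R.

(** For the square roots [s], [t] this is [ln (t / s) <= t / s - 1] multiplied by [2 * s ^+ 2]. The
    terms [- p + q] make each summand of the relative entropy nonnegative and cancel between two
    probability laws. *)
Lemma hellinger_le_kl p q : 0 <= p -> 0 <= q -> (q = 0 -> p = 0) ->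
  (Num.sqrt p - Num.sqrt q) ^+ 2 <= p * ln p - p * ln q - p + q.
Proof.
move=> p0 q0 qp; have := sqr_sqrtr p0; have := sqr_sqrtr q0.
have := sqrtr_ge0 p; have := sqrtr_ge0 q.
set s := Num.sqrt p; set t := Num.sqrt q => t0 s0 tq sp.
have [p0'|pn0] := eqVneq p 0.
  have s00 : s = 0 by rewrite /s p0' sqrtr0.
  by rewrite s00 p0' !mul0r !sub0r sqrrN tq !oppr0 !add0r.
have qn0 : q != 0 by apply: contra_neq pn0 => /qp.
have pp : 0 < p by rewrite lt_def pn0.
have qq : 0 < q by rewrite lt_def qn0.
have sp0 : 0 < s by rewrite sqrtr_gt0.
have tp0 : 0 < t by rewrite sqrtr_gt0.
have : ln (t / s) <= t / s - 1.
  have := @le_ln1Dx _ (t / s - 1); rewrite addrCA subrr addr0; apply.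
  by rewrite ltrBDl addrN divr_gt0.
rewrite ln_div ?posrE// => h.
rewrite -sp -tq !lnXn// !mulr2n.
have : s ^+ 2 * (ln t - ln s) <= s ^+ 2 * (t / s - 1).
  by rewrite ler_wpM2l// exprn_ge0.
have -> : s ^+ 2 * (t / s - 1) = s * t - s ^+ 2 by field; rewrite gt_eqF.
by nra.
Qed.

(** Pinsker's inequality in linear form, with a free parameter [e] in place of a square root: write
    [|p - q| = |s - t| * (s + t)] and split the product by the weighted arithmetic-geometric mean
    inequality. *)
Lemma dist_le_kl p q (e : R) : 0 <= p -> 0 <= q -> (q = 0 -> p = 0) -> 0 < e ->
  `|p - q| <= (2 * e)^-1 * (p * ln p - p * ln q - p + q) + e * (p + q).
Proof.
move=> p0 q0 qp e0.
have := hellinger_le_kl p0 q0 qp.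
set K := _ - p + q => hK.
have := sqr_sqrtr p0; have := sqr_sqrtr q0.
have := sqrtr_ge0 p; have := sqrtr_ge0 q.
move: hK; set s := Num.sqrt p; set t := Num.sqrt q => hK t0 s0 tq sp.
have -> : `|p - q| = `|s - t| * (s + t).
  by rewrite -sp -tq subr_sqr normrM (ger0_norm (addr_ge0 s0 t0)).
have D0 : 0 <= `|s - t| by [].
have D2 : `|s - t| ^+ 2 <= K by rewrite real_normK// num_real.
move: D2; set D := `|s - t| in D0 * => D2.
rewrite -(ler_pM2l (x := 2 * e)) ?mulr_gt0// [leRHS]mulrDr mulVKf; last first.
  by rewrite gt_eqF// mulr_gt0.
have h1 : 0 <= (D - e * (s + t)) ^+ 2 by apply: sqr_ge0.
have h2 : 0 <= e ^+ 2 * (s - t) ^+ 2 by apply: mulr_ge0; apply: sqr_ge0.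
rewrite -sp -tq; nra.
Qed.

End divergence.

Section marginals.
Context d (Omega : measurableType d) (R : realType) (Pr : probability Omega R).
Context (T TQ : finType) (Q : Omega -> TQ).
Hypothesis mQ : frv Q.

Lemma law_pair_comp (T' : finType) (U : Omega -> T) (f : T -> T') s q : frv U ->
  law Pr (fun o => (f (U o), Q o)) (s, q) =
  \sum_(u | f u == s) law Pr (fun o => (U o, Q o)) (u, q).
Proof.
move=> mU; pose UQ o := (U o, Q o).
rewrite [LHS](@law_comp _ _ _ Pr _ _ (fun t => (f t.1, t.2)) UQ); last first.
  exact: frv_pair.
rewrite [LHS](_ : _ = \sum_(t | (f t.1 == s) && (t.2 == q))
    law Pr UQ (t.1, t.2)); last by apply: eq_bigr => -[].
rewrite -(pair_big (fun u => f u == s) (pred1 q) (fun a b => law Pr UQ (a, b))).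
by apply: eq_bigr => i _; rewrite big_pred1_eq.
Qed.

Lemma law_marginal (U : Omega -> T) q : frv U ->
  \sum_u law Pr (fun o => (U o, Q o)) (u, q) = law Pr Q q.
Proof.
move=> mU; have := @law_pair_comp unit U (fun=> tt) tt q mU.
rewrite (eq_bigl xpredT) => [<-|u]; last by rewrite eqxx.
by congr pr; apply/seteqP; split => o /= => [[]|->].
Qed.

Lemma law_marginal_mid (T' : finType) (U : Omega -> T) (V : Omega -> T') u q : frv U -> frv V ->
  \sum_v law Pr (fun o => (U o, (V o, Q o))) (u, (v, q)) =
  law Pr (fun o => (U o, Q o)) (u, q).
Proof.
move=> mU mV; rewrite [RHS](@law_comp _ _ _ Pr _ _
   (fun t => (t.1, t.2.2)) (fun o => (U o, (V o, Q o)))); last first.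
  by apply: frv_pair => //; exact: frv_pair.
rewrite (reindex_omap (fun v => (u, (v, q))) (fun t => Some t.2.1))/=; last first.
  by move=> [u' [v q']] /=; rewrite xpair_eqE => /andP[/eqP-> /eqP->].
by apply: eq_bigl => v; rewrite !eqxx.
Qed.

End marginals.

Section mutual_information.
Context d (Omega : measurableType d) (R : realType) (Pr : probability Omega R).
Context (TU TV TW : finType).
Context (U : Omega -> TU) (V : Omega -> TV) (W : Omega -> TW).

(** The conditional mutual information [I(U; V | W)], in the form that involves joint entropies
    only. *)
Definition cmi : R := entropy Pr (fun o => (U o, W o)) +
  entropy Pr (fun o => (V o, W o)) - entropy Pr (fun o => (U o, (V o, W o))) -
  entropy Pr W.

(** Where [law Pr W t.2] is 0 the quotient is 0 by convention and the joint masses vanish too, so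
    [dep] is 0 there. *)
Definition dep (u : TU) (t : TV * TW) : R :=
  law Pr (fun o => (U o, (V o, W o))) (u, t) -
  law Pr (fun o => (V o, W o)) t * (law Pr (fun o => (U o, W o)) (u, t.2) / law Pr W t.2).

(* The L1 distance between the joint law of (U, V, W) and the law making U and V
   conditionally independent given W. *)
Definition cond_dep : R := \sum_t \sum_u `|dep u t|.

Hypotheses (mU : frv U) (mV : frv V) (mW : frv W).

Let Z o := (U o, (V o, W o)).
Let mZ : frv Z. Proof. by apply: frv_pair => //; exact: frv_pair. Qed.

Let pUW (t : TU * (TV * TW)) := law Pr (fun o => (U o, W o)) (t.1, t.2.2).
Let pVW (t : TU * (TV * TW)) := law Pr (fun o => (V o, W o)) t.2.
Let pW (t : TU * (TV * TW)) := law Pr W t.2.2.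
Let p t := law Pr Z t.
Let q t := pVW t * (pUW t / pW t).

Let p_le_UW t : p t <= pUW t.
Proof. exact: (@law_le_comp _ _ _ Pr _ _ (fun t => (t.1, t.2.2)) Z t mZ). Qed.
Let p_le_VW t : p t <= pVW t.
Proof. exact: (@law_le_comp _ _ _ Pr _ _ snd Z t mZ). Qed.
Let p_le_W t : p t <= pW t.
Proof. exact: (@law_le_comp _ _ _ Pr _ _ (fun t => t.2.2) Z t mZ). Qed.

Let p0 t : 0 <= p t. Proof. exact: law_ge0. Qed.
Let q0 t : 0 <= q t.
Proof. by rewrite !mulr_ge0 ?invr_ge0//; exact: law_ge0. Qed.

Let pq t : q t = 0 -> p t = 0.
Proof.
move=> qt; apply/eqP; rewrite eq_le p0 andbT leNgt; apply/negP => pt.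
have : 0 < q t; last by rewrite qt ltxx.
by rewrite mulr_gt0 ?divr_gt0// (lt_le_trans pt).
Qed.

Let sum_q : \sum_t q t = 1.
Proof.
have mVW : frv (fun o => (V o, W o)) by exact: frv_pair.
rewrite [LHS](_ : _ = \sum_(t : TU * (TV * TW))
    (fun u vw => q (u, vw)) t.1 t.2); last by apply: eq_bigr => -[].
rewrite -(pair_bigA _ (fun u vw => q (u, vw))) exchange_big/=.
rewrite -(@law_sum1 _ _ _ Pr _ _ mVW); apply: eq_bigr => -[v w] _.
rewrite /q /pVW /pUW /pW/= -mulr_sumr -mulr_suml law_marginal//.
have [w0|w0] := eqVneq (law Pr W w) 0; last by rewrite divff// mulr1.
rewrite w0 mul0r mulr0; apply/esym/eqP; rewrite eq_le law_ge0 andbT -w0.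
exact: (@law_le_comp _ _ _ Pr _ _ snd _ (v, w) mVW).
Qed.

(** The relative entropy of the joint law [p] with respect to [q]; both have total mass 1, so the
    corrections [- p + q] sum to 0. *)
Let cmiE : cmi = \sum_t (p t * ln (p t) - p t * ln (q t) - p t + q t).
Proof.
rewrite big_split/= sum_q sumrB (@law_sum1 _ _ _ Pr _ _ mZ) subrK sumrB.
rewrite /cmi (@entropy_comp _ _ _ Pr _ _ (fun t => (t.1, t.2.2)) Z mZ).
rewrite (@entropy_comp _ _ _ Pr _ _ snd Z mZ).
rewrite (@entropy_comp _ _ _ Pr _ _ (fun t => t.2.2) Z mZ) /entropy.
rewrite !opprK -!sumrN -!big_split/=.
apply: eq_bigr => t _.
have := p0 t; rewrite le_eqVlt => /predU1P[|pt].
  by rewrite /p => <-; rewrite !mul0r; ring.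
have hU := lt_le_trans pt (p_le_UW t).
have hV := lt_le_trans pt (p_le_VW t).
have hW := lt_le_trans pt (p_le_W t).
rewrite /q lnM ?posrE ?divr_gt0// ln_div ?posrE//.
rewrite /pUW /pVW /pW /p /Z /comp/=; ring.
Qed.

Lemma cmi_ge0 : 0 <= cmi.
Proof.
rewrite cmiE; apply: sumr_ge0 => t _.
exact: le_trans (sqr_ge0 _) (hellinger_le_kl (p0 t) (q0 t) (@pq t)).
Qed.

Lemma cond_dep_le_cmi (e : R) : 0 < e -> cond_dep <= (2 * e)^-1 * cmi + 2 * e.
Proof.
move=> e0; apply: (@le_trans _ _ (\sum_t ((2 * e)^-1 *
   (p t * ln (p t) - p t * ln (q t) - p t + q t) + e * (p t + q t)))).
  rewrite /cond_dep exchange_big pair_bigA/=.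
  apply: ler_sum => -[u t] _; exact: dist_le_kl (p0 _) (q0 _) (@pq _) e0.
rewrite big_split/= -!mulr_sumr -cmiE big_split/= (@law_sum1 _ _ _ Pr _ _ mZ) sum_q.
by rewrite mulrC -[1 + 1]/(2%:R) [e * _]mulrC [cmi * _]mulrC.
Qed.

End mutual_information.

(** * Information rates *)

Definition segment (a : int) (n : nat) : seq int := [seq a + i%:Z | i <- iota 0 n].

Lemma mem_segment a n i : (i \in segment a n) = (a <= i < a + n%:Z).
Proof.
apply/mapP/idP => [[x]|/andP[h1 h2]]; first by rewrite mem_iota => ? ->; lia.
by exists `|i - a|%N; [rewrite mem_iota; lia|lia].
Qed.

Definition rect (ts : seq nat) (a : int) (n : nat) : seq (nat * int) :=
  [seq (t, i) | t <- ts, i <- segment a n].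

Lemma mem_rect ts a n t i :
  ((t, i) \in rect ts a n) = (t \in ts) && (a <= i < a + n%:Z).
Proof.
apply/allpairsP/andP => [[[t' i'] /= [h1 h2 [-> ->]]]|[h1 h2]].
  by rewrite -mem_segment.
by exists (t, i); rewrite mem_segment.
Qed.

(* The lexicographic past of site [(j.+1, 0)], cut to the window [-m, m],
   without the time-zero row. *)
Definition past (j m : nat) : seq (nat * int) :=
  rect (iota 1 j) (- m%:Z) m.*2.+1 ++ rect [:: j.+1] (- m%:Z) m.

Definition initial (m : nat) : seq (nat * int) := rect [:: 0%N] (- m%:Z) m.*2.+1.

Lemma mem_past j m t i : ((t, i) \in past j m) =
  [&& (1 <= t < j.+1)%N, - m%:Z <= i & i <= m%:Z] ||
  [&& t == j.+1, - m%:Z <= i & i < 0].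
Proof.
rewrite /past mem_cat !mem_rect mem_iota inE.
by congr (_ && _ || _ && _); lia.
Qed.

Lemma mem_initial m t i : ((t, i) \in initial m) =
  [&& t == 0%N, - m%:Z <= i & i <= m%:Z].
Proof. by rewrite /initial mem_rect inE; congr (_ && _); lia. Qed.

Lemma archi_le0 (R : realType) (x y : R) :
  (forall n : nat, n%:R * x <= y) -> x <= 0.
Proof.
move=> h; rewrite leNgt; apply/negP => x0.
have := h (Num.truncn (y / x)).+1; rewrite leNgt => /negP; apply.
by rewrite -ltr_pdivrMr// truncnS_gt.
Qed.

Lemma cvg_sum_nat (R : realType) (u : nat -> nat -> R) (l : nat -> R) k :
  (forall j, u j m @[m --> \oo] --> l j) ->
  (\sum_(j < k) u j m) @[m --> \oo] --> \sum_(j < k) l j.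
Proof.
move=> h; elim: k => [|k IH].
  rewrite big_ord0; under eq_fun do rewrite big_ord0; exact: cvg_cst.
rewrite big_ord_recr/=; under eq_fun do rewrite big_ord_recr/=.
by apply: cvgD.
Qed.

Section information_rate.
Context (R : realType) (h : seq (nat * int) -> R) (c : R).

(** With [h] the entropy of a finite list of sites, this is conditional entropy. The hypotheses
    below retain of entropy its value on the empty list, monotonicity, submodularity, a bound [c]
    per site and invariance under shifts inside the rows; by [h_mono], lists act as sets. *)
Definition cond (x : nat * int) (s : seq (nat * int)) : R := h (x :: s) - h s.

Hypothesis h_nil : h [::] = 0.
Hypothesis h_mono : forall s t, {subset s <= t} -> h s <= h t.
Hypothesis h_cond : forall x s t, {subset s <= t} -> cond x t <= cond x s.
Hypothesis h_one : forall x, h [:: x] <= c.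
Hypothesis h_shift : forall z s, h [seq (x.1, x.2 + z) | x <- s] = h s.

Let h_eqi s t : s =i t -> h s = h t.
Proof. by move=> st; apply/eqP; rewrite eq_le !h_mono// => x; rewrite st. Qed.

Let cond_ge0 x s : 0 <= cond x s.
Proof. by rewrite subr_ge0; apply: h_mono => y ys; rewrite inE ys orbT. Qed.

Let cond_le x s : cond x s <= c.
Proof.
apply: le_trans (h_one x); rewrite -[leRHS]subr0 -h_nil.
exact: (@h_cond x [::] s).
Qed.

Let cond_shift z x s :
  cond (x.1, x.2 + z) [seq (x.1, x.2 + z) | x <- s] = cond x s.
Proof. by rewrite /cond -(h_shift z (x :: s)) -(h_shift z s). Qed.

(** The predecessors of [(j.+1, i)] in lexicographic order inside the columns [[0, n)], without row
    0. *)
Let before (j i n : nat) := rect (iota 1 j) 0 n ++ rect [:: j.+1] 0 i.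

(** Telescoping site by site. As sets, a row complete at [i = n] is the next row at [i = 0]. *)
Let chain base k n : h (base ++ rect (iota 1 k) 0 n) =
  h base + \sum_(j < k) \sum_(i < n) cond (j.+1, i%:Z) (base ++ before j i n).
Proof.
elim: k => [|k IH]; first by rewrite cats0 big_ord0 addr0.
rewrite big_ord_recr/= addrA -IH; apply/eqP; rewrite addrC -subr_eq; apply/eqP.
rewrite (_ : h (base ++ rect (iota 1 k) 0 n) = h (base ++ before k 0 n)); last first.
  by apply: h_eqi => -[t i]; rewrite /before !(mem_rect, mem_cat, mem_iota, inE); lia.
rewrite (_ : h (base ++ rect (iota 1 k.+1) 0 n) = h (base ++ before k n n)); last first.
  by apply: h_eqi => -[t i]; rewrite /before !(mem_rect, mem_cat, mem_iota, inE); lia.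
rewrite -(telescope_sumr (fun i => h (base ++ before k i n)) (leq0n n)) big_mkord.
apply: eq_bigr => i _; congr (_ - _); apply: h_eqi => -[t i'].
by rewrite /before !(mem_rect, mem_cat, mem_iota, inE) xpair_eqE; lia.
Qed.

Let h_initial n : h (rect [:: 0%N] 0 n) <= n%:R * c.
Proof.
elim: n => [|n IH]; first by rewrite mul0r -h_nil.
rewrite (@h_eqi _ ((0%N, n%:Z) :: rect [:: 0%N] 0 n)); last first.
  by move=> [t i]; rewrite /before !(mem_rect, mem_cat, mem_iota, inE) xpair_eqE; lia.
rewrite -[h _](subrK (h (rect [:: 0%N] 0 n))) -natr1 mulrDl mul1r addrC.
by apply: lerD => //; exact: cond_le.
Qed.

Let a j m := cond (j.+1, 0) (past j m).
Let b j m := cond (j.+1, 0) (initial m ++ past j m).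

(** Two estimates of the entropy of the observations in [n] columns. From below it is [n] times the
    sum of the [al j]. From above, adjoin row 0 at a cost of at most [n * c] and use [b j m] in
    every column at distance at least [m] from the border. Letting the number of columns grow leaves
    [S1 - S2 <= c]. *)
Let rate_bound (al : nat -> R) k m : (forall j m, al j <= a j m) ->
  \sum_(j < k) (al j - b j m) <= c.
Proof.
move=> al_le; rewrite -subr_le0.
set S1 := \sum_(j < k) al j; set S2 := \sum_(j < k) b j m.
rewrite sumrB -/S1 -/S2.
(* [n'] will count the interior columns; the constant collects all terms not proportional to it,
   which come from two border strips of [m] columns. *)
apply: (@archi_le0 _ _ (m.*2%:R * (c + k%:R * c - S1))) => n'.
pose n := (m + n' + m)%N.
have low : n%:R * S1 <= h (rect (iota 1 k) 0 n).
  rewrite -[rect _ _ _](cat0s) (chain [::]) h_nil add0r mulr_sumr.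
  apply: ler_sum => j _; rewrite mulr_natl -[X in _ *+ X]card_ord -sumr_const.
  apply: ler_sum => i _; apply: le_trans (al_le j n) _; rewrite /a.
  (* The predecessors inside the window lie in the shifted past of radius [n], and more conditioning
     lowers [cond]. *)
  rewrite -(cond_shift i%:Z)/= add0r; apply: h_cond => -[t x].
  move=> tx; apply/mapP; exists (t, x - i%:Z); last by rewrite /= subrK.
  move: tx; rewrite mem_past /before !(mem_rect, mem_cat, mem_iota, inE).
  by have := ltn_ord i; lia.
have up : h (rect (iota 1 k) 0 n) <=
    n%:R * c + \sum_(j < k) (m%:R * c + n'%:R * b j m + m%:R * c).
  apply: (@le_trans _ _ (h (rect [:: 0%N] 0 n ++ rect (iota 1 k) 0 n))).
    by apply: h_mono => x xr; rewrite mem_cat xr orbT.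
  rewrite (chain (rect [:: 0%N] 0 n)); apply: lerD => //.
  apply: ler_sum => j _.
  rewrite -(big_mkord xpredT (fun i => cond (j.+1, i%:Z)
     (rect [:: 0%N] 0 n ++ before j i n))).
  rewrite (big_cat_nat _ (n := m + n'))//= ?leq_addr//.
  rewrite (big_cat_nat _ (n := m))//= ?leq_addr//.
  have E p q : (p%:R * c : R) = \sum_(q <= i < q + p) c.
    by rewrite sumr_const_nat mulr_natl addKn.
  rewrite [X in _ <= X + _ + _](E m 0%N) add0n [X in _ <= _ + X](E m (m + n')%N).
  apply: lerD; last by apply: ler_sum => i _.
  apply: lerD; first by apply: ler_sum => i _.
  rewrite [leRHS](_ : _ = \sum_(m <= i < m + n') b j m); last first.
    by rewrite sumr_const_nat mulr_natl addKn.
  rewrite big_nat_cond [leRHS]big_nat_cond.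
  apply: ler_sum => i; rewrite andbT => /andP[mi im].
  have -> : b j m =
      cond (j.+1, i%:Z) [seq (x.1, x.2 + i%:Z) | x <- initial m ++ past j m].
    by rewrite /b -(cond_shift i%:Z) /= add0r.
  (* As [m <= i < m + n'], the shifted past of radius [m] stays inside the window. *)
  apply: h_cond => -[t x] /mapP[[t' x']].
  rewrite mem_cat mem_initial mem_past => tx [-> ->].
  by rewrite /before !(mem_rect, mem_cat, mem_iota, inE); lia.
have {low up al_le} := le_trans low up.
rewrite !big_split/= -!mulr_sumr -/S2 !sumr_const card_ord.
rewrite -[c *+ k]mulr_natl /n -addnn !natrD -subr_ge0 => le0; rewrite -subr_ge0.
by apply: etrans le0; congr (0 <= _); ring.
Qed.

Let b_noninc j : nonincreasing_seq (b j).
Proof.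
move=> m m' mm; apply: h_cond => -[t i].
by rewrite mem_cat mem_past mem_initial mem_cat mem_past mem_initial; lia.
Qed.
Let a_noninc j : nonincreasing_seq (a j).
Proof.
move=> m m' mm; apply: h_cond => -[t i].
by rewrite !mem_past; lia.
Qed.

(** The difference [a j m - b j m] need not be monotone in [m], but [a j] and [b j] each are; their
    limits differ by [D j >= 0], and the [D j] have sum at most [c]. *)
Lemma cond_initial_vanishes (e : R) : 0 < e ->
  exists J, forall j, (J <= j)%N -> exists M, forall m, (M <= m)%N ->
    cond (j.+1, 0) (past j m) - cond (j.+1, 0) (initial m ++ past j m) <= e.
Proof.
move=> e0.
have cva j : a j @ \oo --> inf (range (a j)).
  by apply: nonincreasing_cvgn => //; exists 0 => _ [m _ <-]; exact: cond_ge0.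
have cvb j : b j @ \oo --> inf (range (b j)).
  by apply: nonincreasing_cvgn => //; exists 0 => _ [m _ <-]; exact: cond_ge0.
pose D j := inf (range (a j)) - inf (range (b j)).
have cvab j : (a j m - b j m) @[m --> \oo] --> D j by apply: cvgB.
have D0 j : 0 <= D j.
  rewrite subr_ge0; apply: (ler_cvg_to (cvb j) (cva j)).
  by apply: nearW => m; apply: h_cond => x xp; rewrite mem_cat xp orbT.
(* The limits are taken separately: [rate_bound] accepts the infimum of [a j] as [al j], and then
   [m] tends to infinity in [b] alone. *)
have Dsum k : \sum_(j < k) D j <= c.
  have cv : (\sum_(j < k) (inf (range (a j)) - b j m)) @[m --> \oo] -->
      \sum_(j < k) D j.
    apply: (cvg_sum_nat (u := fun j m => inf (range (a j)) - b j m)) => j.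
    by apply: cvgB => //; exact: cvg_cst.
  apply: (cvgr_to_le cv) => /=; apply: nearW => m.
  apply: (rate_bound (al := fun j => inf (range (a j)))) => j m'.
  by apply: ge_inf; [exists 0 => _ [? _ <-]; exact: cond_ge0|exists m'].
have Dcv : D @ \oo --> 0.
  apply: cvg_series_cvg_0; apply: nondecreasing_is_cvgn.
    by apply/nondecreasing_seqP => n; rewrite /series/= big_nat_recr//= lerDl.
  by exists c => _ [k _ <-]; rewrite /series/= big_mkord.
have [J _ HJ] := cvgr_lt _ Dcv _ e0.
exists J => j /HJ /= Dj; have [M _ HM] := cvgr_le _ (cvab j) _ Dj.
by exists M => m /HM.
Qed.

End information_rate.

(** * Entropy of finite families of coordinates *)

Definition vec (I : eqType) (S : finType) (Omega : Type) (Z : I -> Omega -> S)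
  (s : seq I) (o : Omega) : (size s).-tuple S := map_tuple (Z^~ o) (in_tuple s).

Lemma vec_eqP (I : eqType) (S : finType) (Omega : Type) (Z : I -> Omega -> S)
    (s : seq I) (o o' : Omega) :
  vec Z s o = vec Z s o' <-> {in s, forall i, Z i o = Z i o'}.
Proof.
split=> [/(congr1 val)/= /eq_in_map//|h].
by apply: val_inj => /=; apply/eq_in_map.
Qed.

Lemma frv_vec d (Omega : measurableType d) (I : eqType) (S : finType)
    (Z : I -> Omega -> S) (s : seq I) :
  {in s, forall i, frv (Z i)} -> frv (vec Z s).
Proof.
elim: s => [|i s IH] mZ.
  rewrite (_ : vec Z [::] = fun=> [tuple]); first exact: frv_cst.
  by apply/funext => o; apply: val_inj.
have mi : frv (Z i) by apply: mZ; exact: mem_head.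
have ms : frv (vec Z s) by apply: IH => j js; apply: mZ; rewrite inE js orbT.
rewrite (_ : vec Z (i :: s) =
    (fun t => cons_tuple t.1 t.2) \o (fun o => (Z i o, vec Z s o))).
  by apply: frv_comp; exact: frv_pair.
by apply/funext => o; apply: val_inj.
Qed.

Section field_entropy.
Context d (Omega : measurableType d) (R : realType) (Pr : probability Omega R).
Context (S : finType) (Z : nat * int -> Omega -> S).
Hypothesis mZ : forall x, frv (Z x).
Hypothesis Z_shift : forall z s t,
  law Pr (vec Z s) t = law Pr (vec (fun x => Z (x.1, x.2 + z)) s) t.

Let h s := entropy Pr (vec Z s).
Let mvec s : frv (vec Z s). Proof. exact: frv_vec. Qed.

(** Entropy sees only the partition generated by a variable, so different encodings of one family of
    coordinates can be exchanged. *)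
Let entropy_eq (T T' : finType) (U : Omega -> T) (V : Omega -> T') :
  frv U -> frv V -> (forall o o', U o = U o' <-> V o = V o') ->
  entropy Pr U = entropy Pr V.
Proof.
by move=> mU mV UV; apply/eqP; rewrite eq_le !le_entropy// => o o' /UV.
Qed.

Let h_nil : h [::] = 0.
Proof.
apply/eqP; rewrite eq_le entropy_ge0// andbT -(entropy_unit Pr).
by apply: le_entropy; [exact: frv_cst|move=> o o' _; exact/vec_eqP].
Qed.

Let h_mono (s t : seq (nat * int)) : {subset s <= t} -> h s <= h t.
Proof.
move=> st; apply: le_entropy => // o o' /vec_eqP e.
by apply/vec_eqP => i /st; exact: e.
Qed.

Lemma cmi_vec x s t : cmi Pr (Z x) (vec Z t) (vec Z s) =
  cond h x s - cond h x (t ++ s).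
Proof.
rewrite /cmi /cond /h.
rewrite (@entropy_eq _ _ _ (vec Z (x :: s)))//; last 2 first.
- exact: frv_pair.
- move=> o o'; rewrite vec_eqP; split => [[e1 /eq_in_map e2] y|e].
    by rewrite inE => /predU1P[->//|]; exact: e2.
  congr (_, _); first by apply: e; exact: mem_head.
  by apply/vec_eqP => y ys; apply: e; rewrite inE ys orbT.
rewrite (@entropy_eq _ _ (fun o => (vec Z t o, vec Z s o)) (vec Z (t ++ s)))//; last 2 first.
- exact: frv_pair.
- move=> o o'; rewrite vec_eqP; split => [[/eq_in_map e1 /eq_in_map e2] y|e].
    by rewrite mem_cat => /orP[/e1|/e2].
  by congr (_, _); apply/vec_eqP => y ys; apply: e; rewrite mem_cat ys ?orbT.
rewrite (@entropy_eq _ _ (fun o => (Z x o, (vec Z t o, vec Z s o)))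
  (vec Z (x :: t ++ s)))//; last 2 first.
- by apply: frv_pair => //; exact: frv_pair.
- move=> o o'; rewrite vec_eqP; split => [[e1 /eq_in_map e2 /eq_in_map e3] y|e].
    by rewrite inE mem_cat => /orP[/eqP->//|/orP[/e2|/e3]].
  congr (_, (_, _)); first by apply: e; exact: mem_head.
    by apply/vec_eqP => y ys; apply: e; rewrite inE mem_cat ys ?orbT.
  by apply/vec_eqP => y ys; apply: e; rewrite inE mem_cat ys ?orbT.
ring.
Qed.

(** Submodularity is nonnegativity of the conditional mutual information of [x] and [t] given [s];
    since [s] is contained in [t], [t ++ s] has the elements of [t]. *)
Let h_cond x (s t : seq (nat * int)) : {subset s <= t} -> cond h x t <= cond h x s.
Proof.
move=> st; have := cmi_ge0 Pr (mZ x) (@mvec t) (@mvec s).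
rewrite cmi_vec subr_ge0 /cond.
have E r r' : r =i r' -> h r = h r'.
  by move=> e; apply/eqP; rewrite eq_le !h_mono// => y; rewrite e.
have ts : t ++ s =i t.
  by move=> y; rewrite mem_cat; case: (boolP (y \in s)) => [/st->|]; rewrite ?orbF.
by rewrite (E (x :: t ++ s) (x :: t)) ?(E (t ++ s) t)// => y; rewrite !inE ts.
Qed.

Let h_one x : h [:: x] <= #|S|%:R.
Proof.
apply: le_trans (entropy_le_card Pr (Z x)); apply: le_entropy => // o o' e.
by apply/vec_eqP => y; rewrite inE => /eqP->.
Qed.

(** Invariance in law concerns the shifted field on the list [s]; the field on the shifted list is
    encoded by tuples of another type, hence [entropy_eq]. *)
Let h_shift z s : h [seq (x.1, x.2 + z) | x <- s] = h s.
Proof.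
have -> : h s = entropy Pr (vec (fun x => Z (x.1, x.2 + z)) s).
  by rewrite /h /entropy; congr (- _); apply: eq_bigr => t _; rewrite (Z_shift z).
apply: entropy_eq => //; first exact: frv_vec.
move=> o o'; rewrite !vec_eqP; split => e x.
  by move=> xs; apply: e; apply/mapP; exists x.
by move=> /mapP[y ys ->]; exact: e.
Qed.

Lemma initial_dependence_vanishes (e : R) : 0 < e ->
  exists J, forall j, (J <= j)%N -> exists M, forall m, (M <= m)%N ->
  cond_dep Pr (Z (j.+1, 0)) (vec Z (initial m)) (vec Z (past j m)) <= e.
Proof.
move=> e0.
(* Information at most [e ^+ 2 / 4] and the parameter [e / 4] turn the linear Pinsker bound into
   [e / 2 + e / 2]. *)
have e4 : 0 < e ^+ 2 / 4 by rewrite divr_gt0// exprn_gt0.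
have [J HJ] := cond_initial_vanishes h_nil h_mono h_cond h_one h_shift e4.
exists J => j /HJ[M HM]; exists M => m /HM hm.
apply: le_trans (cond_dep_le_cmi Pr (mZ _) (@mvec _) (@mvec _) (e := e / 4) _) _.
  by rewrite divr_gt0.
rewrite cmi_vec; apply: (@le_trans _ _ ((2 * (e / 4))^-1 * (e ^+ 2 / 4) + 2 * (e / 4))).
  by rewrite lerD2r ler_wpM2l// invr_ge0 mulr_ge0// divr_ge0// ltW.
rewrite le_eqVlt; apply/orP; left; apply/eqP; field.
by rewrite gt_eqF.
Qed.

End field_entropy.

(** * Conditional dependence *)

Section cond_dep_theory.
Context d (Omega : measurableType d) (R : realType) (Pr : probability Omega R).

Section maps.
Context (T TV TW : finType) (U : Omega -> T) (V : Omega -> TV) (W : Omega -> TW).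
Hypotheses (mU : frv U) (mV : frv V) (mW : frv W).

Let mVW : frv (fun o => (V o, W o)). Proof. exact: frv_pair. Qed.

Lemma dep_comp (T' : finType) (f : T -> T') s t :
  dep Pr (f \o U) V W s t = \sum_(u | f u == s) dep Pr U V W u t.
Proof.
rewrite /dep sumrB -mulr_sumr -mulr_suml.
by rewrite -(law_pair_comp _ mVW)// -(law_pair_comp _ mW).
Qed.

(** Data processing: [dep] of an image is the sum of [dep] over a fibre, so the L1 norm cannot
    grow. *)
Lemma cond_dep_comp (T' : finType) (f : T -> T') :
  cond_dep Pr (f \o U) V W <= cond_dep Pr U V W.
Proof.
apply: ler_sum => t _; rewrite [leRHS](partition_big f predT)//=.
apply: ler_sum => s _; rewrite dep_comp; exact: ler_norm_sum.
Qed.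

End maps.

(** When [Y] is [X] seen through a channel [K] that ignores [V] and [W], [dep] of [Y] is [dep] of
    [X] multiplied by [K], and the right inverse [M] recovers the latter. Joining [Y] to [X] costs
    nothing because the rows of [K] sum to 1. *)
Lemma cond_dep_channel (T TV TW : finType) (X Y : Omega -> T) (V : Omega -> TV)
    (W : Omega -> TW) (K M : T -> T -> R) :
  frv X -> frv Y -> frv V -> frv W ->
  (forall x y q, law Pr (fun o => ((X o, Y o), (V o, W o))) ((x, y), q) =
    K x y * law Pr (fun o => (X o, (V o, W o))) (x, q)) ->
  (forall x y, 0 <= K x y) -> (forall x, \sum_y K x y = 1) ->
  (forall x x', \sum_y K x y * M y x' = (x == x')%:R) ->
  cond_dep Pr (fun o => (X o, Y o)) V W <=
    (\sum_x \sum_y `|M y x|) * cond_dep Pr Y V W.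
Proof.
move=> mX mY mV mW hK K0 K1 KM.
have mXY : frv (fun o => (X o, Y o)) by exact: frv_pair.
have hKW x y w : law Pr (fun o => ((X o, Y o), W o)) ((x, y), w) =
    K x y * law Pr (fun o => (X o, W o)) (x, w).
  rewrite -(law_marginal_mid _ mW _ _ mXY mV) -(law_marginal_mid _ mW _ _ mX mV).
  by rewrite mulr_sumr; apply: eq_bigr => v _; exact: hK.
have depXY x y t : dep Pr (fun o => (X o, Y o)) V W (x, y) t =
    K x y * dep Pr X V W x t.
  by rewrite /dep hK hKW; ring.
have depY y t : dep Pr Y V W y t = \sum_x K x y * dep Pr X V W x t.
  rewrite (dep_comp mXY mV mW snd).
  rewrite (reindex_omap (fun x => (x, y)) (fun t => Some t.1))/=; last first.
    by move=> [x' y'] /= /eqP->.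
  by apply: eq_big => [x|x _]; rewrite ?eqxx// depXY.
have depX x t : dep Pr X V W x t = \sum_y M y x * dep Pr Y V W y t.
  under eq_bigr do rewrite depY mulr_sumr.
  rewrite exchange_big/= (bigD1 x)//= [X in _ + X]big1 => [|x' xx'].
    under eq_bigr do rewrite mulrCA mulrA.
    by rewrite -mulr_suml KM eqxx mul1r addr0.
  under eq_bigr do rewrite mulrCA mulrA.
  by rewrite -mulr_suml KM (negbTE xx') mul0r.
rewrite /cond_dep mulr_sumr; apply: ler_sum => t _.
rewrite [leLHS](_ : _ = \sum_x `|dep Pr X V W x t|); last first.
  rewrite [LHS](_ : _ = \sum_xy (fun x y => `|dep Pr (fun o => (X o, Y o)) V W (x, y) t|)
     xy.1 xy.2); last by apply: eq_bigr => -[].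
  rewrite -(pair_bigA _ (fun x y => `|dep Pr (fun o => (X o, Y o)) V W (x, y) t|))/=.
  apply: eq_bigr => x _; under eq_bigr do rewrite depXY normrM ger0_norm//.
  by rewrite -mulr_suml K1 mul1r.
rewrite mulr_suml; apply: ler_sum => x _; rewrite depX mulr_suml.
apply: le_trans (ler_norm_sum _ _ _) _; apply: ler_sum => y _.
rewrite normrM ler_wpM2l// (bigD1 y)//= lerDl; exact: sumr_ge0.
Qed.

(** Bayes' rule for [dep]: it equals [dep] of the pair minus [dep] of [U2] times the conditional law
    of [U1] given [U2] and [W], whose mass is at most 1. Each of the two terms is bounded by the
    dependence of the pair, hence the factor 2. *)
Lemma cond_dep_chain (T1 T2 TV TW : finType) (U1 : Omega -> T1) (U2 : Omega -> T2)
    (V : Omega -> TV) (W : Omega -> TW) :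
  frv U1 -> frv U2 -> frv V -> frv W ->
  cond_dep Pr U1 V (fun o => (U2 o, W o)) <=
    2 * cond_dep Pr (fun o => (U1 o, U2 o)) V W.
Proof.
move=> m1 m2 mV mW.
have m12 : frv (fun o => (U1 o, U2 o)) by exact: frv_pair.
rewrite mulr_natl mulr2n.
pose p u1 u2 w := law Pr (fun o => (U1 o, (U2 o, W o))) (u1, (u2, w)).
pose p2 u2 w := law Pr (fun o => (U2 o, W o)) (u2, w).
have m2W : frv (fun o => (U2 o, W o)) by exact: frv_pair.
have sum_p u2 w : \sum_u1 p u1 u2 w = p2 u2 w by exact: law_marginal.
have p_ge0 u1 u2 w : 0 <= p u1 u2 w by exact: law_ge0.
have pt v u1 u2 w : `|dep Pr U1 V (fun o => (U2 o, W o)) u1 (v, (u2, w))| <=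
    `|dep Pr (fun o => (U1 o, U2 o)) V W (u1, u2) (v, w)| +
    p u1 u2 w / p2 u2 w * `|dep Pr U2 V W u2 (v, w)|.
  rewrite -[X in X * _]ger0_norm; last by apply: divr_ge0; exact: law_ge0.
  rewrite -normrM; apply: le_trans (ler_normB _ _).
  rewrite le_eqVlt; apply/orP; left; apply/eqP; congr `|_|.
  rewrite /dep/= -/(p u1 u2 w) -/(p2 u2 w).
  have -> : law Pr (fun o => (V o, (U2 o, W o))) (v, (u2, w)) =
      law Pr (fun o => (U2 o, (V o, W o))) (u2, (v, w)).
    by congr pr; apply/seteqP; split => o /= [-> -> ->].
  have -> : law Pr (fun o => (U1 o, (V o, (U2 o, W o)))) (u1, (v, (u2, w))) =
      law Pr (fun o => (U1 o, U2 o, (V o, W o))) (u1, u2, (v, w)).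
    by congr pr; apply/seteqP; split => o /= [-> -> -> ->].
  have -> : law Pr (fun o => (U1 o, U2 o, W o)) (u1, u2, w) = p u1 u2 w.
    by congr pr; apply/seteqP; split => o /= [-> -> ->].
  have [p20|p20] := eqVneq (p2 u2 w) 0; last first.
    by rewrite -[p u1 u2 w](divfK p20) mulfK//; ring.
  have -> : p u1 u2 w = 0.
    apply/eqP; rewrite eq_le p_ge0 andbT -p20 -sum_p (bigD1 u1)//= lerDl.
    exact: sumr_ge0.
  by rewrite !(mul0r, mulr0, subr0).
have key v u2 w : \sum_u1 `|dep Pr U1 V (fun o => (U2 o, W o)) u1 (v, (u2, w))| <=
    \sum_u1 `|dep Pr (fun o => (U1 o, U2 o)) V W (u1, u2) (v, w)| +
    `|dep Pr U2 V W u2 (v, w)|.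
  apply: (@le_trans _ _ (\sum_u1 (`|dep Pr (fun o => (U1 o, U2 o)) V W (u1, u2) (v, w)| +
      p u1 u2 w / p2 u2 w * `|dep Pr U2 V W u2 (v, w)|))).
    by apply: ler_sum => u1 _; exact: pt.
  rewrite big_split/= lerD2l -!mulr_suml sum_p ler_piMl//.
  by have [->|h] := eqVneq (p2 u2 w) 0; rewrite ?mul0r// divff.
apply: (@le_trans _ _ (\sum_(t : TV * TW) (\sum_u `|dep Pr (fun o => (U1 o, U2 o)) V W u t| +
   \sum_u2 `|dep Pr U2 V W u2 t|))).
  rewrite /cond_dep [leLHS](_ : _ = \sum_(t : TV * (T2 * TW)) (fun v s =>
     \sum_u `|dep Pr U1 V (fun o => (U2 o, W o)) u (v, s)|) t.1 t.2); last first.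
    by apply: eq_bigr => -[].
  rewrite -(pair_bigA _ (fun v s =>
     \sum_u `|dep Pr U1 V (fun o => (U2 o, W o)) u (v, s)|))/=.
  rewrite [leRHS](_ : _ = \sum_(t : TV * TW) (fun v w =>
     (\sum_u `|dep Pr (fun o => (U1 o, U2 o)) V W u (v, w)| +
     \sum_u2 `|dep Pr U2 V W u2 (v, w)|)) t.1 t.2); last first.
    by apply: eq_bigr => -[].
  rewrite -(pair_bigA _ (fun v w =>
     (\sum_u `|dep Pr (fun o => (U1 o, U2 o)) V W u (v, w)| +
     \sum_u2 `|dep Pr U2 V W u2 (v, w)|)))/=.
  apply: ler_sum => v _.
  rewrite [leLHS](_ : _ = \sum_(s : T2 * TW) (fun u2 w =>
     \sum_u `|dep Pr U1 V (fun o => (U2 o, W o)) u (v, (u2, w))|) s.1 s.2); last first.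
    by apply: eq_bigr => -[].
  rewrite -(pair_bigA _ (fun u2 w =>
     \sum_u `|dep Pr U1 V (fun o => (U2 o, W o)) u (v, (u2, w))|))/=.
  rewrite exchange_big/=; apply: ler_sum => w _.
  apply: (@le_trans _ _ (\sum_u2
      (\sum_u1 `|dep Pr (fun o => (U1 o, U2 o)) V W (u1, u2) (v, w)| +
       `|dep Pr U2 V W u2 (v, w)|))).
    by apply: ler_sum => u2 _; exact: key.
  rewrite big_split/= lerD2r exchange_big/= pair_bigA/=.
  by apply: ler_sum => -[].
by rewrite big_split/= lerD2l; exact: (@cond_dep_comp _ _ _ _ _ _ m12 mV mW _ snd).
Qed.

(** Coupling inequality: only outcomes with [p.1 != p.2] contribute, each at two values of [t]. *)
Lemma law_dist_le (T : finType) (U U' : Omega -> T) : frv U -> frv U' ->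
  \sum_t `|law Pr U t - law Pr U' t| <= 2 * pr Pr [set o | U o != U' o].
Proof.
move=> mU mU'; pose UU o := (U o, U' o).
have mUU : frv UU by exact: frv_pair.
have H : \sum_t `|law Pr U t - law Pr U' t| <=
    \sum_t \sum_p law Pr UU p * `|(p.1 == t)%:R - (p.2 == t)%:R|.
  apply: ler_sum => t _.
  rewrite (_ : law Pr U t = \sum_p law Pr UU p * (p.1 == t)%:R); last first.
    rewrite -(law_expect Pr fst (fun s => (s == t)%:R) mUU) (bigD1 t)//= eqxx mulr1.
    by rewrite big1 ?addr0// => s /negbTE->; rewrite mulr0.
  rewrite (_ : law Pr U' t = \sum_p law Pr UU p * (p.2 == t)%:R); last first.
    rewrite -(law_expect Pr snd (fun s => (s == t)%:R) mUU) (bigD1 t)//= eqxx mulr1.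
    by rewrite big1 ?addr0// => s /negbTE->; rewrite mulr0.
  rewrite -sumrB; apply: le_trans (ler_norm_sum _ _ _) _.
  by apply: ler_sum => p _; rewrite -mulrBr normrM ger0_norm ?law_ge0.
apply: le_trans H _.
rewrite (pr_frv Pr (fun t => t.1 != t.2) mUU) mulr_sumr exchange_big/=.
rewrite [leRHS]big_mkcond/=; apply: ler_sum => -[x y] _ /=.
rewrite -mulr_sumr; have [->|xy] := eqVneq x y.
  by rewrite big1 ?mulr0// => t _; rewrite subrr normr0.
rewrite mulrC ler_wpM2r ?law_ge0// (bigD1 x)//= (bigD1 y)/=; last by rewrite eq_sym.
rewrite !eqxx big1 => [|t /andP[tx ty]].
  rewrite [y == x]eq_sym (negbTE xy) subr0 sub0r normrN !normr1 addr0.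
  by rewrite -[1 + 1]/(2%:R).
by rewrite ![_ == t]eq_sym (negbTE tx) (negbTE ty) subrr normr0.
Qed.

(** The joint law and its conditionally independent version each move by at most twice the
    probability that [U] and [U'] differ, hence the constant 4; for the second, [r] sums to at most
    1 over the values of [V]. *)
Lemma cond_dep_perturb (T TV TW : finType) (U U' : Omega -> T) (V : Omega -> TV)
    (W : Omega -> TW) : frv U -> frv U' -> frv V -> frv W ->
  cond_dep Pr U V W <= cond_dep Pr U' V W + 4 * pr Pr [set o | U o != U' o].
Proof.
move=> mU mU' mV mW.
have mVW : frv (fun o => (V o, W o)) by exact: frv_pair.
pose D1 u t := `|law Pr (fun o => (U o, (V o, W o))) (u, t) -
   law Pr (fun o => (U' o, (V o, W o))) (u, t)|.
pose D2 u w := `|law Pr (fun o => (U o, W o)) (u, w) -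
   law Pr (fun o => (U' o, W o)) (u, w)|.
pose r (t : TV * TW) := law Pr (fun o => (V o, W o)) t / law Pr W t.2.
have r0 t : 0 <= r t by rewrite divr_ge0 ?law_ge0.
have pt u t : `|dep Pr U V W u t| <= `|dep Pr U' V W u t| + (D1 u t + r t * D2 u t.2).
  rewrite -(ger0_norm (r0 t)) /D2 -normrM.
  apply: le_trans (lerD (lexx _) (ler_normB _ _)).
  apply: le_trans (ler_normD _ _); rewrite le_eqVlt; apply/orP; left; apply/eqP.
  by congr `|_|; rewrite /dep /r; ring.
have S1 : \sum_t \sum_u D1 u t <= 2 * pr Pr [set o | U o != U' o].
  have := law_dist_le (frv_pair mU mVW) (frv_pair mU' mVW).
  rewrite exchange_big pair_bigA/= => h; apply: le_trans (le_trans h _).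
    by apply: ler_sum => -[].
  rewrite (_ : [set _ | _] = [set o | U o != U' o])//.
  by apply/seteqP; split => o /=; rewrite xpair_eqE eqxx andbT.
have S2 : \sum_t \sum_u r t * D2 u t.2 <= 2 * pr Pr [set o | U o != U' o].
  have := law_dist_le (frv_pair mU mW) (frv_pair mU' mW).
  move=> h; apply: le_trans (le_trans h _); last first.
    rewrite (_ : [set _ | _] = [set o | U o != U' o])//.
    by apply/seteqP; split => o /=; rewrite xpair_eqE eqxx andbT.
  rewrite [leRHS](_ : _ = \sum_(t : T * TW) (fun u w => D2 u w) t.1 t.2); last first.
    by apply: eq_bigr => -[].
  rewrite -(pair_bigA _ (fun u w => D2 u w))/= [leRHS]exchange_big/=.
  under eq_bigr do rewrite -mulr_sumr.
  rewrite [leLHS](_ : _ = \sum_(t : TV * TW)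
    (fun v w => r (v, w) * \sum_u D2 u w) t.1 t.2); last by apply: eq_bigr => -[].
  rewrite -(pair_bigA _ (fun v w => r (v, w) * \sum_u D2 u w))/= [leLHS]exchange_big/=.
  apply: ler_sum => w _; rewrite -mulr_suml ler_piMl//.
    by apply: sumr_ge0 => u _; exact: normr_ge0.
  rewrite /r/= -mulr_suml law_marginal//.
  by have [->|h0] := eqVneq (law Pr W w) 0; rewrite ?mul0r// divff.
apply: (@le_trans _ _ (cond_dep Pr U' V W +
    (\sum_t \sum_u D1 u t + \sum_t \sum_u r t * D2 u t.2))).
  rewrite /cond_dep -!big_split/=; apply: ler_sum => t _.
  by rewrite -!big_split/=; apply: ler_sum => u _.
by rewrite lerD2l; move: S1 S2; lra.
Qed.

End cond_dep_theory.

(** * Conditional probabilities and finite windows *)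

Section real_expectation.
Context d (Omega : measurableType d) (R : realType) (Pr : probability Omega R).
Implicit Types h : Omega -> R.

Definition intg h := Pr.-integrable setT (EFin \o h).
Definition Ex h : R := \int[Pr]_o h o.

Lemma intgD h1 h2 : intg h1 -> intg h2 -> intg (fun o => h1 o + h2 o).
Proof. by move=> i1 i2; exact: (integrableD _ i1 i2). Qed.

Lemma ExD h1 h2 : intg h1 -> intg h2 ->
  Ex (fun o => h1 o + h2 o) = Ex h1 + Ex h2.
Proof. by move=> i1 i2; rewrite /Ex RintegralD. Qed.

Lemma intgZ k h : intg h -> intg (fun o => k * h o).
Proof. by move=> i1; exact: (integrableZl _ k i1). Qed.

Lemma ExZ k h : intg h -> Ex (fun o => k * h o) = k * Ex h.
Proof. by move=> i1; rewrite /Ex RintegralZl. Qed.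

Lemma intgB h1 h2 : intg h1 -> intg h2 -> intg (fun o => h1 o - h2 o).
Proof. by move=> i1 i2; exact: (integrableB _ i1 i2). Qed.

Lemma ExB h1 h2 : intg h1 -> intg h2 ->
  Ex (fun o => h1 o - h2 o) = Ex h1 - Ex h2.
Proof. by move=> i1 i2; rewrite /Ex RintegralB. Qed.

Lemma intg_abs h : intg h -> intg (fun o => `|h o|).
Proof. by move=> i1; exact: (integrable_abse i1). Qed.

Lemma intg_ind B : measurable B -> intg (\1_B : Omega -> R).
Proof. exact: integrable_indic. Qed.

Lemma Ex_ind B : measurable B -> Ex (\1_B : Omega -> R) = pr Pr B.
Proof.
by move=> mB; rewrite /Ex /Rintegral integral_indic// setIT.
Qed.

Lemma intg_mul_ind h B : measurable B -> intg h -> intg (fun o => h o * \1_B o).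
Proof.
move=> mB ih; have : Pr.-integrable B (EFin \o h).
  exact: integrableS ih.
move/(integrable_mkcond _ mB); congr (Pr.-integrable _ _).
by rewrite restrict_EFin patch_indic.
Qed.

Lemma Ex_mul_ind h B : Ex (fun o => h o * \1_B o) = \int[Pr]_(o in B) h o.
Proof. by rewrite [RHS]Rintegral_mkcond patch_indic. Qed.

Lemma le_Ex h1 h2 : intg h1 -> intg h2 -> (forall o, h1 o <= h2 o) -> Ex h1 <= Ex h2.
Proof. by move=> i1 i2 h12; apply: le_Rintegral => // o _; exact: h12. Qed.

Lemma Ex_abs h : intg h -> `|Ex h| <= Ex (fun o => `|h o|).
Proof. by move=> ih; exact: le_normr_Rintegral. Qed.

Lemma intg_cst k : intg (fun=> k).
Proof. exact: (finite_measure_integrable_cst Pr k). Qed.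

Lemma Ex_cst k : Ex (fun=> k) = k.
Proof. by rewrite /Ex Rintegral_cst// -/(pr Pr setT) prT mulr1. Qed.

Lemma intg_sum (I : Type) (s : seq I) (h : I -> Omega -> R) :
  (forall i, intg (h i)) -> intg (fun o => \sum_(i <- s) h i o).
Proof.
move=> ih; elim: s => [|i s IH].
  by under eq_fun do rewrite big_nil; exact: intg_cst.
by under eq_fun do rewrite big_cons; exact: intgD.
Qed.

Lemma Ex_sum (I : Type) (s : seq I) (h : I -> Omega -> R) :
  (forall i, intg (h i)) ->
  Ex (fun o => \sum_(i <- s) h i o) = \sum_(i <- s) Ex (h i).
Proof.
move=> ih; elim: s => [|i s IH].
  by under eq_fun do rewrite big_nil; rewrite big_nil Ex_cst.
under eq_fun do rewrite big_cons; rewrite big_cons ExD// ?IH//.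
exact: intg_sum.
Qed.

Section finite.
Context (T : finType) (U : Omega -> T).
Hypothesis mU : frv U.

Let atom t : set Omega := U @^-1` [set t].

Let sum_atom (F : T -> R) o : F (U o) = \sum_t F t * \1_(atom t) o.
Proof.
rewrite (bigD1 (U o))//= big1 => [|t tU].
  by rewrite indicE mem_set// mulr1 addr0.
by rewrite indicE memNset ?mulr0// => /= e; rewrite e eqxx in tU.
Qed.

Lemma intg_fin (F : T -> R) : intg (F \o U).
Proof.
rewrite (_ : F \o U = fun o => \sum_t F t * \1_(atom t) o).
  by apply: intg_sum => t; apply: intgZ; apply: intg_ind; exact: mU.
by apply/funext => o; exact: sum_atom.
Qed.

Lemma Ex_fin (F : T -> R) : Ex (F \o U) = \sum_t law Pr U t * F t.
Proof.
rewrite (_ : F \o U = fun o => \sum_t F t * \1_(atom t) o); last first.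
  by apply/funext => o; exact: sum_atom.
have ia t : intg (\1_(atom t)) by apply: intg_ind; exact: mU.
rewrite Ex_sum => [|t]; last exact: intgZ.
by apply: eq_bigr => t _; rewrite ExZ// Ex_ind 1?mulrC//; exact: mU.
Qed.

Lemma sum_Ex_atoms h : intg h ->
  \sum_t `|Ex (fun o => h o * \1_(atom t) o)| <= Ex (fun o => `|h o|).
Proof.
move=> ih; have ia t : intg (fun o => `|h o * \1_(atom t) o|).
  by apply: intg_abs; apply: intg_mul_ind => //; exact: mU.
apply: (@le_trans _ _ (\sum_t Ex (fun o => `|h o * \1_(atom t) o|))).
  by apply: ler_sum => t _; apply: Ex_abs; apply: intg_mul_ind => //; exact: mU.
rewrite -Ex_sum//; apply: le_Ex; [exact: intg_sum|exact: intg_abs|move=> o].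
rewrite [leRHS](sum_atom (fun=> `|h o|) o); apply: ler_sum => t _.
by rewrite normrM (ger0_norm (_ : 0 <= \1_(atom t) o :> R))// indicE.
Qed.

End finite.

Lemma cond_prob_Ex (G : set (set Omega)) (A : set Omega) f B :
  measurable A -> measurable B -> cond_prob Pr G A f -> G B ->
  Ex (fun o => f o * \1_B o) = pr Pr (A `&` B).
Proof. by move=> mA mB [_ _ h] GB; rewrite Ex_mul_ind /Rintegral h. Qed.

End real_expectation.

(** * Density of finite windows in a generated sigma-algebra *)

Section approximation.
Context d (Omega : measurableType d) (R : realType) (Pr : probability Omega R).
Context (C : set (set Omega)) (T : nat -> finType) (V : forall m, Omega -> T m).
Hypothesis mV : forall m, frv (V m).
Hypothesis mC : C `<=` measurable.
Hypothesis C_resolved : forall E, C E -> exists M, forall m, (M <= m)%N ->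
  exists Q : pred (T m), E = [set o | Q (V m o)].

Let mismatch (E : set Omega) m (Q : pred (T m)) : set Omega :=
  [set o | `[< E o >] != Q (V m o)].

Let m_mismatch E m Q : measurable E -> measurable (@mismatch E m Q).
Proof.
move=> mE; have := frv_pair (frv_pred mE) (@mV m).
by move/(_ [set t | t.1 != Q t.2]).
Qed.

(** Approximation is required for all large [m]: two approximable sets then have a common [m]
    although the [V m] are not assumed to be nested. *)
Let approx (E : set Omega) := measurable E /\ forall e : R, 0 < e ->
  exists M, forall m, (M <= m)%N ->
  exists Q : pred (T m), pr Pr (mismatch E Q) <= e.

Let approxU E F : approx E -> approx F -> approx (E `|` F).
Proof.
move=> [mE aE] [mF aF]; split; first exact: measurableU.
move=> e e0; have e2 : 0 < e / 2 by rewrite divr_gt0.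
have [M1 H1] := aE _ e2; have [M2 H2] := aF _ e2.
exists (maxn M1 M2) => m; rewrite geq_max => /andP[/H1[Q1 q1] /H2[Q2 q2]].
exists (predU Q1 Q2); apply: (@le_trans _ _ (e / 2 + e / 2)); last first.
  by rewrite -splitr.
apply: (@le_trans _ _ (pr Pr (mismatch E Q1) + pr Pr (mismatch F Q2))); last exact: lerD.
rewrite -lee_fin EFinD -!prE//; try exact: m_mismatch; last first.
  by apply: m_mismatch; exact: measurableU.
apply: le_trans (measureU2 _ (m_mismatch _ mE) (m_mismatch _ mF)).
apply: le_measure; rewrite ?inE; [|apply: measurableU; exact: m_mismatch|].
  by apply: m_mismatch; exact: measurableU.
move=> o; rewrite /mismatch/= asbool_or.
have [->|nE] := eqVneq `[< E o >] (Q1 (V m o)); last by left.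
have [->|nF] := eqVneq `[< F o >] (Q2 (V m o)); last by right.
by rewrite eqxx.
Qed.

Let approx0 : approx set0.
Proof.
split=> // e e0; exists 0%N => m _; exists pred0.
rewrite (_ : mismatch _ _ = set0); first by rewrite /pr measure0 ltW.
by apply/seteqP; split => o //=; rewrite /mismatch/= asboolF.
Qed.

(** The approximable sets form a sigma-algebra containing [C]. For a countable union, half of [e]
    pays for truncating it and half for approximating the finite union. *)
Lemma approx_set E : <<s C >> E -> forall e : R, 0 < e ->
  exists M, forall m, (M <= m)%N ->
  exists Q : pred (T m), pr Pr [set o | `[< E o >] != Q (V m o)] <= e.
Proof.
suff H : <<s C >> `<=` approx by move=> /H[].
apply: smallest_sub; last first.
  move=> F CF; split; first exact: mC.
  move=> e e0; have [M H] := C_resolved CF; exists M => m /H[Q QE]; exists Q.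
  rewrite (_ : mismatch _ _ = set0); first by rewrite /pr measure0 ltW.
  by apply/seteqP; split => o //=; rewrite /mismatch/= QE/= asboolb eqxx.
split => //.
- move=> F [mF aF]; split; first by rewrite setTD; exact: measurableC.
  move=> e e0; have [M H] := aF _ e0; exists M => m /H[Q q].
  exists (predC Q); rewrite (_ : mismatch _ _ = mismatch F Q)//.
  rewrite setTD; apply/seteqP; split => o; rewrite /mismatch/= asbool_neg.
    by case: `[< F o >]; case: (Q _).
  by case: `[< F o >]; case: (Q _).
- move=> F aF; have mF n : measurable (F n) by case: (aF n).
  have mU : measurable (\bigcup_k F k) by exact: bigcupT_measurable.
  split=> // e e0.
  pose Fn n := \big[setU/set0]_(k < n.+1) F k.
  have aFn n : approx (Fn n).
    elim: n => [|n IH]; rewrite /Fn big_ord_recr/=; last exact: approxU.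
    by rewrite big_ord0 set0U.
  have e2 : 0 < e / 2 by rewrite divr_gt0.
  have mFn n : measurable (Fn n) by case: (aFn n).
  have cvFn : pr Pr (Fn n) @[n --> \oo] --> pr Pr (\bigcup_k F k).
    apply: fine_cvg; rewrite -prE// -bigcup_bigsetU_bigcup.
    apply: (@nondecreasing_cvg_mu _ _ _ Pr Fn) => //.
      by rewrite /Fn bigcup_bigsetU_bigcup.
    by move=> n m nm; apply/subsetPset; exact: subset_bigsetU.
  have [n _ /(_ n (leqnn n))/= hn] :
      \forall n \near \oo, pr Pr (\bigcup_k F k) - e / 2 < pr Pr (Fn n).
    by apply: (cvgr_gt _ cvFn); rewrite ltrBlDr ltrDl.
  have [_ /(_ _ e2)[M H]] := aFn n; exists M => m /H[Q q]; exists Q.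
  have FnF : Fn n `<=` \bigcup_k F k by rewrite -bigcup_bigsetU_bigcup; exact: bigcup_sup.
  have mD : measurable (\bigcup_k F k `\` Fn n) by exact: measurableD.
  apply: (@le_trans _ _ (pr Pr (\bigcup_k F k `\` Fn n) + pr Pr (mismatch (Fn n) Q))).
    rewrite -lee_fin EFinD -!prE//; try exact: m_mismatch.
    apply: le_trans (measureU2 _ mD (m_mismatch _ (mFn n))).
    apply: le_measure; rewrite ?inE; [exact: m_mismatch| |].
      by apply: measurableU => //; exact: m_mismatch.
    move=> o; rewrite /mismatch/=.
    case: (asboolP (Fn n o)) => FnE; case: (asboolP ((\bigcup_k F k) o)) => FE h.
    - by right.
    - by exfalso; exact/FE/FnF.
    - by left.
    - by right.
  have : pr Pr (\bigcup_k F k) = pr Pr (Fn n) + pr Pr (\bigcup_k F k `\` Fn n).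
    rewrite -prU//; first by rewrite setDUK.
    by apply/seteqP; split => // o /= [? []].
  by move: q hn; lra.
Qed.

(** The average of the indicators of [i / N.+1 < x] rounds [x] up to a multiple of the step. *)
Let staircase (x : R) N : 0 <= x <= 1 ->
  `|x - \sum_(i < N.+1) N.+1%:R^-1 * (i%:R / N.+1%:R < x)%R%:R| <= N.+1%:R^-1.
Proof.
move=> /andP[x0 x1]; set y := x * N.+1%:R.
have y0 : 0 <= y by rewrite mulr_ge0.
have yN : y <= N.+1%:R by rewrite ler_piMl.
pose c n : R := \sum_(i < n) (i%:R < y)%R%:R.
have cP n : [/\ n%:R <= y -> c n = n%:R, c n <= y + 1 & c n <= n%:R] /\
    (y <= n%:R -> y <= c n).
  elim: n => [|n [[IH1 IH2 IH3] IH4]].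
    rewrite /c big_ord0; split; first by split => //; rewrite addr_ge0.
    by [].
  rewrite /c big_ord_recr/= -/(c n) -natr1.
  case: (ltP n%:R y) => ny /=.
    by rewrite (IH1 (ltW ny)); split=> //; split=> //; rewrite lerD2r ltW.
  rewrite addr0; split; last by move=> _; exact: IH4.
  split=> // [h|]; last by rewrite (le_trans IH3)// lerDl.
  by exfalso; move: h ny; lra.
have [[_ h2 _] /(_ yN) h1] := cP N.+1.
have -> : \sum_(i < N.+1) N.+1%:R^-1 * (i%:R / N.+1%:R < x)%R%:R = N.+1%:R^-1 * c N.+1.
  rewrite mulr_sumr; apply: eq_bigr => i _; congr (_ * _%:R).
  by rewrite ltr_pdivrMr.
have -> : x = N.+1%:R^-1 * y by rewrite /y mulrCA mulVf ?mulr1.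
rewrite -mulrBr normrM ger0_norm ?invr_ge0// -[leRHS]mulr1 ler_wpM2l ?invr_ge0//.
by rewrite ler_norml; move: h1 h2; lra.
Qed.

(** A version [f] may leave [[0, 1]] and is first clipped. This is free: the excess has expectation
    [P(A and N1) - P(N1) <= 0] above 1 and [- P(A and N0) <= 0] below 0. The level sets of [f] lie
    in the sigma-algebra and are approximated one by one. *)
Lemma approx_cond_prob (A : set Omega) (f : Omega -> R) : measurable A ->
  cond_prob Pr <<s C>> A f -> forall e : R, 0 < e ->
  exists M, forall m, (M <= m)%N -> exists c : T m -> R,
    Ex Pr (fun o => `|f o - c (V m o)|) <= e.
Proof.
move=> mA hf e e0; have [Gf intf _] := hf.
have mG B : <<s C>> B -> measurable B.
  by apply: smallest_sub => //; exact: sigma_algebra_measurable.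
pose N := Num.truncn (2 / e).
have Ne : N.+1%:R^-1 <= e / 2.
  rewrite -[e / 2]invrK lef_pV2 ?posrE ?invr_gt0 ?divr_gt0// invf_div.
  by rewrite ltW// truncnS_gt.
pose level (i : 'I_N.+1) : set Omega := [set o | i%:R / N.+1%:R < f o].
have Glevel i : <<s C>> (level i).
  rewrite (_ : level i = f @^-1` `]i%:R / N.+1%:R, +oo[); first exact: Gf.
  by apply/seteqP; split => o; rewrite /level/= in_itv/= andbT.
have e2 : 0 < e / 2 by rewrite divr_gt0.
have /fin_all_exists[M HM] i := approx_set (Glevel i) e2.
exists (\max_i M i) => m Mm.
have /fin_all_exists[Q HQ] i := HM i m (leq_trans (leq_bigmax i) Mm).
pose c (t : T m) : R := \sum_(i < N.+1) N.+1%:R^-1 * (Q i t)%:R.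
exists c.
pose N0 : set Omega := [set o | f o < 0].
pose N1 : set Omega := [set o | 1 < f o].
have GN0 : <<s C>> N0.
  rewrite (_ : N0 = f @^-1` `]-oo, 0[); first exact: Gf.
  by apply/seteqP; split => o; rewrite /N0/= in_itv.
have GN1 : <<s C>> N1.
  rewrite (_ : N1 = f @^-1` `]1, +oo[); first exact: Gf.
  by apply/seteqP; split => o; rewrite /N1/= in_itv/= andbT.
have mm i : measurable (mismatch (level i) (Q i)) by apply: m_mismatch; exact: mG.
have i1 : intg Pr (fun o => f o * \1_N1 o) by apply: intg_mul_ind => //; exact: mG.
have i0 : intg Pr (fun o => f o * \1_N0 o) by apply: intg_mul_ind => //; exact: mG.
have j1 : intg Pr (\1_N1 : Omega -> R) by apply: intg_ind; exact: mG.
have jm i : intg Pr (fun o => N.+1%:R^-1 * \1_(mismatch (level i) (Q i)) o).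
  by apply: intgZ; exact: intg_ind.
have jc : intg Pr (fun=> N.+1%:R^-1) by exact: intg_cst.
have js := intg_sum (index_enum 'I_N.+1) jm.
(* Clipping error, staircase error, and one mismatch per level. *)
pose bnd o := ((f o * \1_N1 o - \1_N1 o) - f o * \1_N0 o) +
  (N.+1%:R^-1 + \sum_i N.+1%:R^-1 * \1_(mismatch (level i) (Q i)) o).
apply: (@le_trans _ _ (Ex Pr bnd)).
  apply: le_Ex.
  - by apply: intg_abs; apply: intgB => //; exact: intg_fin.
  - by apply: intgD; [apply: intgB => //; exact: intgB|exact: intgD].
  move=> o; rewrite /bnd.
  pose x := Num.max 0 (Num.min 1 (f o)).
  have x01 : 0 <= x <= 1 by rewrite le_max lexx/= ge_max ler01 ge_min lexx.
  have fx : `|f o - x| <= (f o * \1_N1 o - \1_N1 o) - f o * \1_N0 o.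
    rewrite !indicE /x.
    have [f0|f0] := ltP (f o) 0.
      rewrite (mem_set (f0 : N0 o)) memNset; last by apply/negP; rewrite -leNgt; move: f0; lra.
      rewrite min_r ?max_l//; try by move: f0; lra.
      by rewrite ltr0_norm /=; move: f0; lra.
    rewrite (@memNset _ N0); last by apply/negP; rewrite -leNgt; move: f0; lra.
    have [f1|f1] := ltP 1 (f o).
      rewrite (mem_set (f1 : N1 o)) max_r// ger0_norm /=; move: f1; lra.
    rewrite memNset; last by apply/negP; rewrite -leNgt; move: f1; lra.
    by rewrite max_r// subrr normr0 /=; lra.
  apply: le_trans (ler_distD x _ _) _; apply: lerD fx _.
  apply: le_trans (ler_distD (\sum_(i < N.+1) N.+1%:R^-1 * (i%:R / N.+1%:R < x)%R%:R) _ _) _.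
  apply: lerD (staircase _ x01) _.
  rewrite /c -sumrB; apply: le_trans (ler_norm_sum _ _ _) _.
  apply: ler_sum => i _; rewrite -mulrBr normrM ger0_norm ?invr_ge0//.
  rewrite ler_wpM2l ?invr_ge0// indicE.
  (* Clipping does not affect the comparison with a level in [[0, 1)]. *)
  have -> : (i%:R / N.+1%:R < x) = `[< level i o >].
    apply/idP/asboolP; rewrite /level/= /x.
      rewrite lt_max ltNge divr_ge0//= lt_min => /andP[] //.
    move=> h; rewrite lt_max lt_min h andbT; apply/orP; right.
    by rewrite ltr_pdivrMr// mul1r ltr_nat.
  have [->|ne] := eqVneq `[< level i o >] (Q i (V m o)); first by rewrite subrr normr0.
  rewrite mem_set; last exact: ne.
  by case: `[< _ >] (Q i _) => -[]; rewrite ?subrr ?normr0 ?subr0 ?sub0r ?normrN ?normr1.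
rewrite /bnd ExD; [|by apply: intgB => //; exact: intgB|exact: intgD].
rewrite ExB//; last exact: intgB.
rewrite ExB// Ex_ind; last exact: mG.
rewrite !(cond_prob_Ex mA _ hf)//; try exact: mG.
rewrite ExD// Ex_cst Ex_sum//.
have S : \sum_i Ex Pr (fun o => N.+1%:R^-1 * \1_(mismatch (level i) (Q i)) o) <= e / 2.
  apply: (@le_trans _ _ (\sum_(i < N.+1) N.+1%:R^-1 * (e / 2))).
    apply: ler_sum => i _; rewrite ExZ; last exact: intg_ind.
    by rewrite Ex_ind// ler_wpM2l ?invr_ge0//; exact: HQ.
  by rewrite sumr_const card_ord -[leLHS]mulr_natl mulVKf.
have h1 : pr Pr (A `&` N1) <= pr Pr N1.
  by apply: le_pr; [apply: measurableI => //; exact: mG|exact: mG|exact: subIsetr].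
have h0 := pr_ge0 Pr (A `&` N0).
rewrite [e]splitr -[leRHS]add0r; apply: lerD (lerD Ne S).
by move: h0 h1; lra.
Qed.

End approximation.

(** * Conditional probabilities against elementary ones *)

Section comparison.
Context d (Omega : measurableType d) (R : realType) (Pr : probability Omega R).
Context (G H : set (set Omega)) (A : set Omega) (f g : Omega -> R).
Hypotheses (mA : measurable A) (hf : cond_prob Pr H A f) (hg : cond_prob Pr G A g).

Let bA o := `[< A o >].
Let mbA : frv bA. Proof. exact: frv_pred. Qed.

(** An atom of [U] lies in [K], so [k] integrates over it to the mass of [A] there; the left side is
    the L1 norm of [k - c(U)] after averaging on atoms. *)
Lemma atoms_le (K : set (set Omega)) (k : Omega -> R) (T : finType)
    (U : Omega -> T) (c : T -> R) :
  cond_prob Pr K A k -> frv U -> (forall t, K (U @^-1` [set t])) ->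
  \sum_t `|law Pr (fun o => (bA o, U o)) (true, t) - c t * law Pr U t| <=
  Ex Pr (fun o => `|k o - c (U o)|).
Proof.
move=> hk mU KU; have [_ ik _] := hk.
apply: le_trans (sum_Ex_atoms mU (intgB ik (intg_fin Pr mU c))).
apply: ler_sum => t _; rewrite le_eqVlt; apply/orP; left; apply/eqP; congr `|_|.
have mt : measurable (U @^-1` [set t]) by exact: mU.
rewrite (_ : (fun o => _) = fun o =>
    k o * \1_(U @^-1` [set t]) o - c t * \1_(U @^-1` [set t]) o); last first.
  apply/funext => o /=; rewrite mulrBl; congr (_ - _).
  by rewrite indicE; case: (boolP (_ \in _)) => [/set_mem/= ->//|_]; rewrite !mulr0.
rewrite ExB; [|exact: intg_mul_ind|by apply: intgZ; exact: intg_ind].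
rewrite (cond_prob_Ex mA mt hk (KU t)) ExZ ?Ex_ind//; last exact: intg_ind.
congr (_ - _); congr pr; apply/seteqP; split => o /=.
  by move=> [/asboolP].
by move=> [Ao ->]; rewrite /bA asboolT.
Qed.

(** By [atoms_le], [c] and [c'] are as close to the elementary conditional probabilities as to [f]
    and [g], which explains the second copy of each error. What remains is [dep] at the value
    [true]. *)
Lemma cond_prob_dist (TV TW : finType) (V : Omega -> TV) (W : Omega -> TW)
    (c : TV * TW -> R) (c' : TW -> R) :
  frv V -> frv W -> (forall t, H ((fun o => (V o, W o)) @^-1` [set t])) ->
  (forall w, G (W @^-1` [set w])) ->
  Ex Pr (fun o => `|f o - g o|) <=
    2 * Ex Pr (fun o => `|f o - c (V o, W o)|) + 2 * Ex Pr (fun o => `|g o - c' (W o)|) +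
    cond_dep Pr bA V W.
Proof.
move=> mV mW HVW GW; have [_ jf _] := hf; have [_ jg _] := hg.
have mVW : frv (fun o => (V o, W o)) by exact: frv_pair.
have a1 := atoms_le c hf mVW HVW.
have a2 := atoms_le c' hg mW GW.
have ic := intg_fin Pr mVW c.
have ic' := intg_fin Pr mW c'.
have ib := intg_fin Pr mVW (fun t => `|c t - c' t.2|).
have i1 : intg Pr (fun o => `|f o - c (V o, W o)|) by apply: intg_abs; exact: intgB.
have i2 : intg Pr (fun o => `|g o - c' (W o)|) by apply: intg_abs; exact: intgB.
have : Ex Pr (fun o => `|f o - g o|) <= Ex Pr (fun o => `|f o - c (V o, W o)| +
    `|g o - c' (W o)| + `|c (V o, W o) - c' (W o)|).
  apply: le_Ex; [by apply: intg_abs; exact: intgB|by apply: intgD => //; exact: intgD|].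
  move=> o; have -> : f o - g o = (f o - c (V o, W o)) - (g o - c' (W o)) +
    (c (V o, W o) - c' (W o)) by ring.
  apply: le_trans (ler_normD _ _) _; rewrite lerD2r; exact: ler_normB.
rewrite ExD//; last exact: intgD.
rewrite ExD// (Ex_fin Pr mVW (fun t => `|c t - c' t.2|)).
set S := \sum_t _ => h.
suff : S <= Ex Pr (fun o => `|f o - c (V o, W o)|) + Ex Pr (fun o => `|g o - c' (W o)|) +
    cond_dep Pr bA V W by move: h; lra.
apply: le_trans (lerD (lerD a1 a2) (lexx _)).
have -> : \sum_w `|law Pr (fun o => (bA o, W o)) (true, w) - c' w * law Pr W w| =
    \sum_t law Pr (fun o => (V o, W o)) t *
      `|law Pr (fun o => (bA o, W o)) (true, t.2) / law Pr W t.2 - c' t.2|.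
  rewrite -(law_expect Pr snd (fun w =>
    `|law Pr (fun o => (bA o, W o)) (true, w) / law Pr W w - c' w|) mVW).
  apply: eq_bigr => w _; rewrite (_ : snd \o _ = W)//.
  have [w0|w0] := eqVneq (law Pr W w) 0.
    rewrite w0 mul0r mulr0 subr0; apply/eqP; rewrite normr_eq0 eq_le law_ge0 andbT -w0.
    exact: (@law_le_comp _ _ _ Pr _ _ snd _ (true, w) (frv_pair mbA mW)).
  rewrite -[X in _ = X * _](ger0_norm (law_ge0 Pr W w)) -normrM; congr `|_|.
  by field.
rewrite /S /cond_dep -!big_split/=; apply: ler_sum => t _.
apply: (@le_trans _ _ (`|law Pr (fun o => (bA o, (V o, W o))) (true, t) -
     c t * law Pr (fun o => (V o, W o)) t| +
   law Pr (fun o => (V o, W o)) t *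
   `|law Pr (fun o => (bA o, W o)) (true, t.2) / law Pr W t.2 - c' t.2| +
   `|dep Pr bA V W true t|)); last first.
  by rewrite lerD2l (bigD1 true)//= lerDl; exact: sumr_ge0.
set l := law Pr (fun o => (V o, W o)) t; set r := _ / law Pr W t.2.
have l0 : 0 <= l by exact: law_ge0.
have lM x : l * `|x| = `|l * x| by rewrite normrM ger0_norm.
rewrite !lM /dep -/l -/r.
set q := law _ _ _.
have -> : l * (c t - c' t.2) = - (q - c t * l) + l * (r - c' t.2) + (q - l * r) by ring.
by apply: le_trans (ler_normD _ _) _; rewrite lerD2r; apply: le_trans (ler_normD _ _) _;
  rewrite normrN.
Qed.

End comparison.

(** * The noise channel *)

Definition gen (Omega : Type) d (T : measurableType d) (F : set (Omega -> T)) :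
    set (set Omega) :=
  [set E | exists2 f, F f & exists2 B, measurable B & E = f @^-1` B].

Lemma measurable_field d (Omega : measurableType d) (I : Type) d' (T : measurableType d')
    (Phi : Omega -> I -> T) :
  (forall i B, measurable B -> measurable [set o | B (Phi o i)]) ->
  forall B : set (field_space I T), measurable B -> measurable [set o | B (Phi o)].
Proof.
move=> mPhi; apply: smallest_sub; last first.
  by move=> _ [i [B mB ->]]; exact: mPhi.
split.
- by rewrite /= (_ : [set _ | _] = set0).
- move=> B mB; rewrite (_ : [set o | _] = ~` [set o | B (Phi o)]).
    exact: measurableC.
  by apply/seteqP; split => o /=; [case|].
- move=> B mB; rewrite (_ : [set o | _] = \bigcup_k [set o | B k (Phi o)]).
    by apply: bigcupT_measurable => k; exact: mB.
  by apply/seteqP; split => o /= [k _ Bk]; exists k.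
Qed.

Lemma coord_measurable (I : Type) d (T : measurableType d) (i : I) (B : set T) :
  measurable B -> measurable [set c : field_space I T | B (c i)].
Proof. by move=> mB; apply: sub_sigma_algebra; exists i, B. Qed.

Lemma frv_coord (I : Type) d (T : measurableType d) (S : finType) (i : I) (h : T -> S) :
  (forall B : set S, measurable (h @^-1` B)) ->
  frv (fun c : field_space I T => h (c i)).
Proof. by move=> mh B; exact: (coord_measurable i (mh B)). Qed.

Section binary_channel.
Context (R : realType) (p : R) (L : nat).
Implicit Types x y : {ffun 'I_L -> bool}.

Definition noise (b : bool) : R := if b then p else 1 - p.
(** The inverse of the two-state matrix [noise (x (+) y)], whose determinant is [1 - 2 * p]. *)
Definition unnoise (b : bool) : R := (if b then - p else 1 - p) / (1 - 2 * p).

Definition channel x y : R := \prod_l noise (x l (+) y l).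
Definition unchannel y x : R := \prod_l unnoise (y l (+) x l).

Lemma channel_ge0 x y : 0 <= p <= 1 -> 0 <= channel x y.
Proof.
move=> /andP[p0 p1]; apply: prodr_ge0 => l _; rewrite /noise.
by case: ifP => // _; rewrite subr_ge0.
Qed.

Lemma sum_channel x : \sum_y channel x y = 1.
Proof.
rewrite -(bigA_distr_bigA (fun l b => noise (x l (+) b))) big1// => l _.
by rewrite big_bool/= /noise; case: (x l) => /=; ring.
Qed.

Lemma channelK x x' : p != 2^-1 ->
  \sum_y channel x y * unchannel y x' = (x == x')%:R.
Proof.
move=> p2.
have p20 : 1 - 2 * p != 0 by apply: contra_neq p2 => h; lra.
under eq_bigr do rewrite /channel /unchannel -big_split/=.
rewrite -(bigA_distr_bigA (fun l b => noise (x l (+) b) * unnoise (b (+) x' l))).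
have E l : \sum_(b : bool) noise (x l (+) b) * unnoise (b (+) x' l) =
    (x l == x' l)%:R.
  rewrite big_bool/= /noise /unnoise; case: (x l); case: (x' l) => /=; by field.
under eq_bigr do rewrite E.
have [->|xx'] := eqVneq x x'; first by rewrite big1// => l _; rewrite eqxx.
have [l xl] : exists l, x l != x' l.
  apply/existsP; apply: contraR xx' => /existsPn h; apply/eqP/ffunP => l.
  by apply/eqP; have := h l; rewrite negbK.
by rewrite (bigD1 l)//= (negbTE xl) mul0r.
Qed.

End binary_channel.

(** The odd block length makes block 0 the centred interval [[-N, N]]. *)
Definition site (N : nat) (i : int) (l : 'I_(N.*2.+1)) : int :=
  - N%:Z + i * (N.*2.+1)%:Z + l%:Z.

(** Euclidean division of [w + N] by the block length; the sign clauses identify block 0 and the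
    blocks to its left. *)
Lemma site_surj N w : exists i l, w = @site N i l /\
  (w < 0 -> i <= 0) /\ (w <= N%:Z -> i <= 0) /\ (- N%:Z <= w -> 0 <= i).
Proof.
have L0 : (N.*2.+1)%:Z != 0 by [].
pose i := ((w + N%:Z) %/ (N.*2.+1)%:Z)%Z; pose r := ((w + N%:Z) %% (N.*2.+1)%:Z)%Z.
have r0 : 0 <= r by exact: modz_ge0.
have rL : r < (N.*2.+1)%:Z by exact: ltz_pmod.
have rL' : (`|r| < N.*2.+1)%N by lia.
have E : w + N%:Z = i * (N.*2.+1)%:Z + r by exact: divz_eq.
exists i, (Ordinal rL'); rewrite /site/=; split; first by lia.
by split; [|split] => h; move: E r0 rL h; clearbody i r; nia.
Qed.

Lemma site_inj N i (l l' : 'I_(N.*2.+1)) : site 0 l = site i l' -> 0 <= i /\ (i = 0 -> l = l').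
Proof.
move=> E; split; last by move=> i0; apply: val_inj => /=; move: E; rewrite i0 /site; lia.
by have := ltn_ord l; have := ltn_ord l'; move: E; rewrite /site; nia.
Qed.

Section indep_fun.
Context d (Omega : measurableType d) (R : realType) (Pr : probability Omega R).

Lemma law_indep_comp (TD TU TQ : finType) (D : Omega -> TD) (U : Omega -> TU)
    (Q : Omega -> TQ) q e :
  frv D -> frv U -> (forall o o', D o = D o' -> Q o = Q o') ->
  (forall d e, law Pr (fun o => (D o, U o)) (d, e) = law Pr D d * law Pr U e) ->
  law Pr (fun o => (Q o, U o)) (q, e) = law Pr Q q * law Pr U e.
Proof.
move=> mD mU /(factor_through Pr)[f ->] ind.
rewrite (law_pair_comp Pr mU f q e mD) (law_comp Pr f q mD) mulr_suml.
by apply: eq_bigr => t _; exact: ind.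
Qed.

Lemma vec_cylinder (I : eqType) (S : finType) (Z : I -> Omega -> S) (s : seq I)
    (t : (size s).-tuple S) (x0 : S) : uniq s -> exists w,
  forall o, vec Z s o = t <-> {in s, forall i, Z i o = w i}.
Proof.
move=> us; exists (fun i => nth x0 t (index i s)) => o; split => [<- i si|h].
  by rewrite /= (nth_map i) ?nth_index// index_mem.
apply/val_inj/(@eq_from_nth _ x0) => /=; rewrite size_map ?size_tuple// => i ilt.
have [y _] : exists y : I, true by case: (s) ilt => // y; exists y.
by rewrite (nth_map y)// h ?mem_nth// index_uniq.
Qed.

End indep_fun.

Section noise_channel.
Context d (Omega : measurableType d) (R : realType) (Pr : probability Omega R).
Context (p : R) (X Y xi : int -> int -> {RV Pr >-> spin}).
Hypothesis noise_law : forall k v, Pr [set o | spin_val (xi k v o) = -1] = p%:E.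
Hypothesis noise_indep : mutually_independent (fun kv => xi kv.1 kv.2).
Hypothesis noise_signal : independent_fields X xi.

Lemma frv_RV (Z : {RV Pr >-> spin}) : frv Z.
Proof. by move=> B; rewrite -[_ @^-1` _]setTI; exact: measurable_funP. Qed.

Let law_xi k v b : law Pr (xi k v) b = noise p b.
Proof.
have E1 : law Pr (xi k v) true = p.
  rewrite /law /pr -[p]/(fine p%:E) -(noise_law k v); congr (fine (Pr _)).
  by apply/seteqP; split => o /=; case: (xi k v o).
case: b => //=; rewrite -[in RHS]E1 -(law_sum1 Pr (frv_RV (xi k v))) big_bool/=.
by rewrite addrC addrK.
Qed.

Let pr_cylinder (J : seq (int * int)) (w : int * int -> bool) : uniq J ->
  pr Pr [set o | forall i, i \in J -> xi i.1 i.2 o = w i] =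
  \prod_(i <- J) noise p (w i).
Proof.
move=> uJ; apply/EFin_inj; rewrite -prE; last first.
  rewrite (_ : [set o | _] = \bigcap_(i in [set i | i \in J]) (xi i.1 i.2 @^-1` [set w i])).
    apply: fin_bigcap_measurable; first exact: finite_seq.
    by move=> i _; exact: (frv_RV (xi i.1 i.2) [set w i]).
  by apply/seteqP; split => o /= h i; exact: h.
have /= -> := @noise_indep J (fun i => [set w i]) uJ (fun _ => I).
elim: J {uJ} => [|i J IH]; first by rewrite !big_nil.
rewrite !big_cons IH EFinM -(law_xi i.1 i.2) /law -prE//.
exact: (frv_RV (xi i.1 i.2) [set w i]).
Qed.

Variables (N : nat) (k : int).

Definition noise_block (o : Omega) : {ffun 'I_(N.*2.+1) -> bool} :=
  [ffun l => xi k (site 0 l) o].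

Let frv_noise_block : frv noise_block.
Proof. by apply: frv_ffun => l; exact: frv_RV. Qed.

Let blk : seq (int * int) := [seq (k, site 0 l) | l <- enum 'I_(N.*2.+1)].

Let uniq_blk : uniq blk.
Proof.
rewrite map_inj_uniq ?enum_uniq// => l l' [].
by rewrite /site => h; apply: val_inj => /=; lia.
Qed.

(** Adding [N] undoes [site 0], which sends [l] to [l - N]. *)
Let blk_cylinder e o : noise_block o = e <->
  {in blk, forall i, xi i.1 i.2 o = e (inord `|(i.2 + N%:Z)%R|)}.
Proof.
have E (l : 'I_(N.*2.+1)) : inord `|(@site N 0 l + N%:Z)%R| = l :> 'I_(N.*2.+1).
  by apply: val_inj => /=; rewrite inordK /site; have := ltn_ord l; lia.
split => [<- i /mapP[l _ ->]|h]; first by rewrite ffunE E.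
apply/ffunP => l; rewrite ffunE -[in RHS](E l) (h (k, site 0 l))//.
by apply/mapP; exists l; rewrite ?mem_enum.
Qed.

Lemma law_noise_block e : law Pr noise_block e = \prod_l noise p (e l).
Proof.
transitivity (\prod_(i <- blk) noise p (e (inord `|(i.2 + N%:Z)%R|))).
  rewrite -(pr_cylinder (fun i => e (inord `|(i.2 + N%:Z)%R|)) uniq_blk).
  by congr pr; apply/seteqP; split => o /= /blk_cylinder.
rewrite big_map big_enum/=; apply: eq_bigr => l _; congr (noise p (e _)).
by apply: val_inj => /=; rewrite inordK /site; have := ltn_ord l; lia.
Qed.

(** [Q] depends on finitely many signal and noise variables, the latter off the block. Independence
    of the fields splits off the signal; mutual independence of the noise separates [s2] from the
    block. *)
Lemma noise_block_indep (TQ : finType) (Q : Omega -> TQ) (s1 s2 : seq (int * int)) q e :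
  uniq s2 -> (forall l, (k, @site N 0 l) \notin s2) ->
  (forall o o', {in s1, forall i, X i.1 i.2 o = X i.1 i.2 o'} ->
    {in s2, forall i, xi i.1 i.2 o = xi i.1 i.2 o'} -> Q o = Q o') ->
  law Pr (fun o => (Q o, noise_block o)) (q, e) = law Pr Q q * law Pr noise_block e.
Proof.
move=> us2 s2blk hQ.
pose Xf (i : int * int) := X i.1 i.2; pose xf (i : int * int) := xi i.1 i.2.
pose D o := (vec Xf s1 o, vec xf s2 o).
have mX : frv (vec Xf s1) by apply: frv_vec => i _; exact: frv_RV.
have mx : frv (vec xf s2) by apply: frv_vec => i _; exact: frv_RV.
have mD : frv D by exact: frv_pair.
apply: (law_indep_comp q e mD frv_noise_block).
  move=> o o' e'; have /vec_eqP e1 := congr1 fst e'; have /vec_eqP e2 := congr1 snd e'.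
  exact: hQ.
move=> -[a b] {}e.
have mcoord s : frv (vec (fun i (c : field_space (int * int) spin) => c i) s).
  apply: frv_vec => i _.
  exact: (@frv_coord _ _ spin bool i id).
(* Signal against any function of the noise: applied to the noise on [s2] alone and jointly with the
   block. *)
have sig (T : finType) (K : (int * int -> bool) -> T) t :
    frv (K : field_space (int * int) spin -> T) ->
    law Pr (fun o => (vec Xf s1 o, K (fun i => xf i o))) (a, t) =
    law Pr (vec Xf s1) a * law Pr (fun o => K (fun i => xf i o)) t.
  move=> mK; pose B : set (field_space (int * int) spin) :=
    [set c | vec (fun i (c : int * int -> bool) => c i) s1 c = a].
  pose C : set (field_space (int * int) spin) := [set c | K c = t].
  have mB : measurable B.
    exact: (mcoord s1 [set a]).
  have mC : measurable C by exact: (mK [set t]).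
  have := noise_signal mB mC => /(congr1 fine) /=.
  have mU : frv (fun o => K (fun i => xf i o)).
    move=> F; apply: (measurable_field (Phi := fun o i => xf i o) _ (mK F)).
    by move=> i F' _; exact: (frv_RV (xi i.1 i.2) F').
  rewrite fineM; [|exact: (fin_num_measure Pr _ (mX [set a]))|
     exact: (fin_num_measure Pr _ (mU [set t]))].
  move=> <-; congr (fine (Pr _)); apply/seteqP; split => o.
    by move=> /pair_equal_spec.
  by move=> h; apply/pair_equal_spec.
pose Kb c := [ffun l : 'I_(N.*2.+1) => c (k, site 0 l)] : {ffun 'I_(N.*2.+1) -> bool}.
pose Kv (c : int * int -> bool) := vec (fun i (c : int * int -> bool) => c i) s2 c.
have mKb : frv (Kb : field_space (int * int) spin -> _).
  by apply: frv_ffun => l; exact: (@frv_coord _ _ spin bool _ id).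
have mKv : frv (Kv : field_space (int * int) spin -> _).
  exact: mcoord.
have h2 := sig _ Kv b mKv.
have h3 := sig _ (fun c => (Kv c, Kb c)) (b, e) (frv_pair mKv mKb).
have EV : (fun o => Kv (fun i => xf i o)) = vec xf s2.
  by apply/funext => o; apply: val_inj.
have EB : (fun o => Kb (fun i => xf i o)) = noise_block by [].
have h4 : law Pr (fun o => (vec xf s2 o, noise_block o)) (b, e) =
    law Pr (vec xf s2) b * law Pr noise_block e.
  have [w hw] := vec_cylinder xf b false us2.
  pose w1 (i : int * int) := e (inord `|(i.2 + N%:Z)%R|).
  pose w2 i := if i \in s2 then w i else w1 i.
  have blks2 i : i \in blk -> i \notin s2 by move=> /mapP[l _ ->]; exact: s2blk.
  have us : uniq (s2 ++ blk).
    rewrite cat_uniq us2 uniq_blk andbT/=; apply/hasPn => i; exact: blks2.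
  transitivity (\prod_(i <- s2 ++ blk) noise p (w2 i)).
    rewrite -(pr_cylinder w2 us); congr pr; apply/seteqP; split => o /=.
      move=> /pair_equal_spec[/hw h5 /blk_cylinder h6] i.
      rewrite mem_cat /w2 => /orP[is2|ib]; first by rewrite is2; exact: h5.
      by rewrite (negbTE (blks2 _ ib)); exact: h6.
    move=> h; apply/pair_equal_spec; split.
      apply/hw => i is2; rewrite /xf h ?mem_cat ?is2//.
      by rewrite /w2 is2.
    apply/blk_cylinder => i ib; rewrite h ?mem_cat ?ib ?orbT//.
    by rewrite /w2 (negbTE (blks2 _ ib)).
  rewrite big_cat/=; congr (_ * _).
    rewrite (eq_big_seq (fun i => noise p (w i))); last by move=> i is2; rewrite /w2 is2.
    rewrite -(pr_cylinder w us2); congr pr.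
    by apply/seteqP; split => o /= /hw.
  rewrite (eq_big_seq (fun i => noise p (w1 i))); last first.
    by move=> i ib; rewrite /w2 (negbTE (blks2 _ ib)).
  rewrite -(pr_cylinder w1 uniq_blk); congr pr.
  by apply/seteqP; split => o /= /blk_cylinder.
rewrite EV in h2.
rewrite h2 -mulrA -h4; rewrite -EV -EB -h3.
congr pr; apply/seteqP; split => o.
  move=> /pair_equal_spec[/pair_equal_spec[h5 h6] h7].
  by apply/pair_equal_spec; split => //; apply/pair_equal_spec.
move=> /pair_equal_spec[h5 /pair_equal_spec[h6 h7]].
by apply/pair_equal_spec; split => //; apply/pair_equal_spec.
Qed.

Hypothesis obs : forall k v o,
  spin_val (Y k v o) = spin_val (X k v o) * spin_val (xi k v o).

Lemma obs_addb t v o : Y t v o = X t v o (+) xi t v o.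
Proof. by have := obs t v o; case: (Y t v o) (X t v o) (xi t v o) => -[] []. Qed.

Definition block (U : int -> int -> Omega -> bool) (o : Omega) :
  {ffun 'I_(N.*2.+1) -> bool} := [ffun l => U k (site 0 l) o].

(** Multiplication of signs is [(+)] on [spin], so the blocks are [(x, y)] exactly when the signal
    block is [x] and the noise block is [x (+) y]. The noise block is independent of [Q] and the
    signal block together, which is why [blk] is appended to [s1]. *)
Lemma law_block_channel (TQ : finType) (Q : Omega -> TQ) (s1 s2 : seq (int * int))
    x y q :
  uniq s2 -> (forall l, (k, @site N 0 l) \notin s2) ->
  (forall o o', {in s1, forall i, X i.1 i.2 o = X i.1 i.2 o'} ->
    {in s2, forall i, xi i.1 i.2 o = xi i.1 i.2 o'} -> Q o = Q o') ->
  law Pr (fun o => ((block X o, block Y o), Q o)) ((x, y), q) =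
    channel p x y * law Pr (fun o => (block X o, Q o)) (x, q).
Proof.
move=> us2 s2blk hQ.
have := @noise_block_indep _ (fun o => (block X o, Q o)) (s1 ++ blk) s2 (x, q)
  [ffun l => x l (+) y l] us2 s2blk.
rewrite law_noise_block.
have -> : \prod_l noise p ([ffun l => x l (+) y l] l) = channel p x y.
  by apply: eq_bigr => l _; rewrite ffunE.
rewrite [channel p x y * _]mulrC => <-.
  congr pr; apply/seteqP; split => o.
    move=> /pair_equal_spec[/pair_equal_spec[h1 h2] h3].
    apply/pair_equal_spec; split; first exact/pair_equal_spec.
    apply/ffunP => l; rewrite -h1 -h2 !ffunE obs_addb.
    by case: (X _ _ o) (xi _ _ o) => -[].
  move=> /pair_equal_spec[/pair_equal_spec[h1 h3] h2].
  apply/pair_equal_spec; split => //; apply/pair_equal_spec; split => //.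
  apply/ffunP => l; move/ffunP/(_ l) : h2; rewrite -h1 !ffunE obs_addb => ->.
  by case: (X _ _ o) (y l) => -[].
move=> o o' hX hxi; congr (_, _).
  apply/ffunP => l; rewrite !ffunE (hX (k, site 0 l))// mem_cat; apply/orP; right.
  by apply/mapP; exists l; rewrite ?mem_enum.
by apply: hQ => // i i1; apply: hX; rewrite mem_cat i1.
Qed.

End noise_channel.

(** * The block field *)

(* Row 0 is the signal at time 0; row t > 0 is the observation at time t. *)
Definition coarse (Omega : Type) (U V : int -> int -> Omega -> bool) (N : nat)
    (x : nat * int) (o : Omega) : {ffun 'I_(N.*2.+1) -> bool} :=
  [ffun l => if x.1 == 0%N then U 0 (site x.2 l) o else V x.1%:Z (site x.2 l) o].

Lemma site_add N i z (l : 'I_(N.*2.+1)) :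
  site (i + z) l = site i l + z * (N.*2.+1)%:Z.
Proof. by rewrite /site mulrDl; ring. Qed.

Section stationary_field.
Context d (Omega : measurableType d) (R : realType) (Pr : probability Omega R).
Context (X Y : int -> int -> {RV Pr >-> spin}).
Hypothesis shift_inv : forall l w, shift_invariant X Y l w.

Let field := field_space (int * int) (spin * spin)%type.
Let cX k w (c : field) := (c (k, w)).1.
Let cY k w (c : field) := (c (k, w)).2.

Let frv_cX k w : frv (cX k w).
Proof.
apply: (@frv_coord _ _ (spin * spin)%type bool (k, w) fst) => B.
by rewrite -[_ @^-1` _]setTI; exact: measurable_fst.
Qed.

Let frv_cY k w : frv (cY k w).
Proof.
apply: (@frv_coord _ _ (spin * spin)%type bool (k, w) snd) => B.
by rewrite -[_ @^-1` _]setTI; exact: measurable_snd.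
Qed.

(** Shifting by [z] blocks is shifting by [z] block lengths. The event is written on the canonical
    space by applying [coarse] to the coordinate maps [cX] and [cY]. *)
Lemma law_coarse_shift N z s t : law Pr (vec (coarse X Y N) s) t =
  law Pr (vec (fun x => coarse X Y N (x.1, x.2 + z)) s) t.
Proof.
have mB : frv (vec (coarse cX cY N) s).
  by apply: frv_vec => x _; apply: frv_ffun => l; case: (x.1 == 0%N).
have := shift_inv 0 (z * (N.*2.+1)%:Z) (mB [set t]) => /(congr1 fine) /= e.
rewrite /law /pr [LHS]e; congr (fine (Pr _)).
have E o : vec (coarse cX cY N) s (fun kv => (X (kv.1 + 0) (kv.2 + z * (N.*2.+1)%:Z) o,
      Y (kv.1 + 0) (kv.2 + z * (N.*2.+1)%:Z) o)) =
    vec (fun x => coarse X Y N (x.1, x.2 + z)) s o.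
  apply: val_inj; apply: eq_map => x /=; apply/ffunP => l.
  by rewrite !ffunE /cX /cY/= !addr0 site_add.
by apply/seteqP; split => o; rewrite /preimage/= E.
Qed.

(** The window event is found at time 0 and carried to time [k] by stationarity, so [N] and [Q] can
    be fixed before time tends to infinity. *)
Lemma initial_window_approx (A : set config) : measurable A ->
  forall e : R, 0 < e -> exists M, forall N, (M <= N)%N ->
  exists Q : pred {ffun 'I_(N.*2.+1) -> bool}, forall k,
    pr Pr [set o | `[< A (fun w => X k w o) >] != Q (block N k X o)] <= e.
Proof.
move=> mA e e0.
pose C := gen [set (X 0 w : Omega -> spin) | w in setT].
have mV N : frv (block N 0 X) by apply: frv_ffun => l; exact: frv_RV.
have mC : C `<=` measurable.
  by move=> _ [_ [w _ <-] [B _ ->]]; exact: (frv_RV (X 0 w) B).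
have C_res E : C E -> exists M, forall m, (M <= m)%N ->
    exists Q : pred {ffun 'I_(m.*2.+1) -> bool}, E = [set o | Q (block m 0 X o)].
  move=> [_ [w _ <-] [B _ ->]]; exists `|w|%N => m wm.
  have [i [l [wE [_ [hi1 hi2]]]]] := site_surj m w.
  have i0 : i = 0 by apply/eqP; rewrite eq_le hi1 ?hi2//; lia.
  rewrite i0 in wE.
  exists (fun x => `[< B (x l) >]); apply/seteqP; split => o /=.
    by move=> Bw; apply/asboolP; rewrite ffunE -wE.
  by move=> /asboolP; rewrite ffunE -wE.
have CA : <<s C>> [set o | A (fun w => X 0 w o)].
  apply: (@measurable_field _ (g_sigma_algebraType C) int _ spin
     (fun o w => X 0 w o) _ A mA) => w B mB.
  by apply: sub_sigma_algebra; exists (X 0 w); [exists w|exists B].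
have [M HM] := approx_set Pr mV mC C_res CA e0.
exists M => N /HM[Q hQ]; exists Q => k; apply: le_trans hQ.
pose cb (c : field) : {ffun 'I_(N.*2.+1) -> bool} := [ffun l => cX 0 (site 0 l) c].
have mcb : frv cb by apply: frv_ffun => l; exact: frv_cX.
have mcA : measurable [set c : field | A (fun w => cX 0 w c)].
  apply: (@measurable_field _ field int _ spin (fun c w => cX 0 w c) _ A mA) => w B _.
  exact: (frv_cX 0 w B).
have mB := frv_pair (frv_pred mcA) mcb [set t | t.1 != Q t.2].
have := shift_inv k 0 mB => /(congr1 fine) /= e1.
rewrite le_eqVlt; apply/orP; left; apply/eqP.
rewrite /pr [RHS]e1; congr (fine (Pr _)); apply/seteqP.
have E o : (fun w => X (0 + k) (w + 0) o) = (fun w => X k w o).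
  by apply/funext => w; rewrite add0r addr0.
have E' o : [ffun l => X (0 + k) (@site N 0 l + 0) o] = block N k X o.
  by apply/ffunP => l; rewrite !ffunE add0r addr0.
by split => o; rewrite /cb /cX/= E E'.
Qed.

End stationary_field.

(** * Finite windows inside the conditioning sigma-algebras *)

Section generators.
Context d (Omega : measurableType d).

Lemma gen_measurable (F : set (Omega -> spin)) :
  (forall h, F h -> frv h) -> gen F `<=` measurable.
Proof. by move=> hF _ [h /hF mh [B _ ->]]; exact: mh. Qed.

(** With [Omega] carrying the sigma-algebra generated by [F], [frv] expresses measurability with
    respect to the conditioning. *)
Lemma gen_frv (F : set (Omega -> spin)) h : F h ->
  frv (h : g_sigma_algebraType (gen F) -> spin).
Proof. by move=> Fh B; apply: sub_sigma_algebra; exists h => //; exists B. Qed.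

Lemma resolvedP (R : realType) (Pr : probability Omega R) (T : nat -> finType)
    (V : forall m, Omega -> T m) (F : set (Omega -> spin)) :
  (forall h, F h -> exists M, forall m, (M <= m)%N ->
     forall o o', V m o = V m o' -> h o = h o') ->
  forall E, gen F E -> exists M, forall m, (M <= m)%N ->
  exists Q : pred (T m), E = [set o | Q (V m o)].
Proof.
move=> hF _ [h /hF[M HM] [B _ ->]]; exists M => m /HM/(factor_through Pr)[phi ->].
exists (fun t => `[< B (phi t) >]).
by apply/seteqP; split => o /= => [?|/asboolP]; [apply/asboolP|].
Qed.

End generators.

Section initial_field.
Context d (Omega : measurableType d) (R : realType) (Pr : probability Omega R).
Context (X Y : int -> int -> {RV Pr >-> spin}) (N : nat).

Let Vf m := vec (coarse X Y N) (initial m).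

Lemma initial_vars_frv h : initial_vars X h -> frv h.
Proof. by move=> [w _ <-]; exact: frv_RV. Qed.

Lemma initial_frv (F : set (Omega -> spin)) m : initial_vars X `<=` F ->
  frv (Vf m : g_sigma_algebraType (gen F) -> _).
Proof.
move=> hF; apply: frv_vec => -[t i]; rewrite mem_initial => /and3P[/eqP-> _ _].
by apply: frv_ffun => l; apply: gen_frv; apply: hF; exists (site i l).
Qed.

Lemma initial_resolved h : initial_vars X h -> exists M, forall m, (M <= m)%N ->
  forall o o', Vf m o = Vf m o' -> h o = h o'.
Proof.
move=> [w _ <-]; have [i [l [wE _]]] := site_surj N w.
exists `|i|%N => m im o o' /vec_eqP/(_ (0%N, i)).
rewrite mem_initial/= (_ : _ && _ = true); last by lia.
by move=> /(_ isT)/ffunP/(_ l); rewrite !ffunE /= wE.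
Qed.

End initial_field.

Section sigma_fields.
Context d (Omega : measurableType d) (R : realType) (Pr : probability Omega R).
Context (X Y : int -> int -> {RV Pr >-> spin}) (N j : nat) (v : int).

Let k := (j.+1)%:Z.

(* [v] lies in the block at the origin; only its sites left of [v] are in
   [obs_vars Y k v]. *)
Definition seen (y : {ffun 'I_(N.*2.+1) -> bool}) : {ffun 'I_(N.*2.+1) -> bool} :=
  [ffun l => y l && (@site N 0 l < v)].

Let Wf m o := (seen (block N k Y o), vec (coarse X Y N) (past j m) o).

Lemma obs_vars_frv h : obs_vars Y k v h -> frv h.
Proof. by move=> [[t _ [w _ <-]]|[w _ <-]]; exact: frv_RV. Qed.

Hypothesis vN : `|v| <= N%:Z.

(** Since [- N <= v], the blocks of negative index lie entirely to the left of [v], so the past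
    involves observed sites only. *)
Lemma obs_frv (F : set (Omega -> spin)) m : obs_vars Y k v `<=` F ->
  frv (Wf m : g_sigma_algebraType (gen F) -> _).
Proof.
move=> hF; apply: frv_pair.
  rewrite (_ : (fun o => _) = fun o => [ffun l => Y k (site 0 l) o && (@site N 0 l < v)]).
    apply: frv_ffun => l; case: (boolP (site 0 l < v)) => lv.
      under [X in frv X]eq_fun do rewrite andbT.
      by apply: gen_frv; apply: hF; right; exists (site 0 l).
    under [X in frv X]eq_fun do rewrite andbF.
    exact: frv_cst.
  by apply/funext => o; apply/ffunP => l; rewrite !ffunE.
apply: frv_vec => -[t i] ti; apply: frv_ffun => l; move: ti; rewrite mem_past/=.
have [->|t0] := eqVneq t 0%N; first by lia.
move=> h; apply: gen_frv; apply: hF.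
case/orP : h => [h|/and3P[/eqP -> _ i0]].
  by left; exists t%:Z; [rewrite /k/=; lia|exists (site i l)].
right; exists (site i l) => //=; rewrite /site.
by have := ltn_ord l; move: vN i0; nia.
Qed.

(** Since [v <= N], a site left of [v] at time [k] lies in block 0, where [seen] keeps it, or in a
    block of the past. *)
Lemma obs_resolved h : obs_vars Y k v h -> exists M, forall m, (M <= m)%N ->
  forall o o', Wf m o = Wf m o' -> h o = h o'.
Proof.
have past_res t w m o o' i (l : 'I_(N.*2.+1)) : w = site i l -> t != 0%N -> (t, i) \in past j m ->
    Wf m o = Wf m o' -> Y t%:Z w o = Y t%:Z w o'.
  move=> -> t0 ti /(congr1 snd)/vec_eqP/(_ _ ti)/ffunP/(_ l).
  by rewrite !ffunE/= (negbTE t0).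
move=> [[t /andP[t1 tk] [w _ <-]]|[w wv <-]]; have [i [l [wE [hi1 [hi2 hi3]]]]] := site_surj N w.
  have tE : t = `|t|%N%:Z by lia.
  exists `|i|%N => m im o o'; rewrite tE; apply: (past_res _ _ _ _ _ i l) => //; first by lia.
  by rewrite mem_past; move: tk; rewrite /k; lia.
have i0 : i <= 0 by apply: hi2; move: wv => /=; lia.
exists `|i|%N => m im o o'.
have [ie|ine] := eqVneq i 0; last first.
  by apply: (past_res _ _ _ _ _ i l) => //; rewrite mem_past; lia.
move=> /(congr1 fst)/ffunP/(_ l); rewrite !ffunE -ie -wE.
by move: wv => /= ->; rewrite !andbT.
Qed.

End sigma_fields.

(** * From the observed block to an event of the signal *)

Section dependence.
Context d (Omega : measurableType d) (R : realType) (Pr : probability Omega R).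
Context (p : R) (X Y xi : int -> int -> {RV Pr >-> spin}).
Hypothesis p01 : 0 <= p <= 1.
Hypothesis p_half : p != 2^-1.
Hypothesis noise_law : forall k v, Pr [set o | spin_val (xi k v o) = -1] = p%:E.
Hypothesis noise_indep : mutually_independent (fun kv => xi kv.1 kv.2).
Hypothesis noise_signal : independent_fields X xi.
Hypothesis obs : forall k v o,
  spin_val (Y k v o) = spin_val (X k v o) * spin_val (xi k v o).
Variable N : nat.

Let Z := coarse X Y N.

Let frv_block (U : int -> int -> {RV Pr >-> spin}) k : frv (block N k U).
Proof. by apply: frv_ffun => l; exact: frv_RV. Qed.

Lemma frv_coarse x : frv (Z x).
Proof. by apply: frv_ffun => l; case: (x.1 == 0%N); exact: frv_RV. Qed.

Let frv_vecZ s : frv (vec Z s).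
Proof. by apply: frv_vec => x _; exact: frv_coarse. Qed.

(** Bounds the L1 norm of the inverse channel on a block, uniformly in time and window. *)
Definition inverse_mass : R :=
  \sum_(x : {ffun 'I_(N.*2.+1) -> bool}) \sum_y `|unchannel p y x|.

Lemma signal_dep j m :
  cond_dep Pr (fun o => (block N j.+1 X o, block N j.+1 Y o))
    (vec Z (initial m)) (vec Z (past j m)) <=
  inverse_mass * cond_dep Pr (Z (j.+1, 0)) (vec Z (initial m)) (vec Z (past j m)).
Proof.
(* Past observations need signal and noise at their sites; the initial window needs the signal
   alone. *)
pose s2 : seq (int * int) :=
  undup [seq (x.1%:Z, site x.2 l) | x <- past j m, l <- enum 'I_(N.*2.+1)].
pose s1 : seq (int * int) :=
  [seq (0%Z, site x.2 l) | x <- initial m, l <- enum 'I_(N.*2.+1)] ++ s2.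
apply: (@cond_dep_channel _ _ _ Pr _ _ _ _ _ _ _ (@channel R p N.*2.+1)) => //.
- move=> x y q.
  apply: (law_block_channel noise_law noise_indep noise_signal obs (s1 := s1) (s2 := s2)).
  + exact: undup_uniq.
  (* At time [j.+1] the past has only blocks of negative index, which miss block 0. *)
  + move=> l; rewrite mem_undup; apply/allpairsP => -[[[t i] l'] /=].
    rewrite mem_past => -[h _ [ht hl]].
    by have [i0 _] := site_inj hl; lia.
  + move=> o o' hX hxi; congr (_, _); apply/vec_eqP => -[t i] ti; apply/ffunP => l.
      rewrite !ffunE/=; have := ti; rewrite mem_initial => /andP[/eqP-> _]/=.
      apply: (hX (0%Z, site i l)); rewrite mem_cat; apply/orP; left.
      by apply/allpairsP; exists ((t, i), l); rewrite ti mem_enum.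
    have tl : (t%:Z, site i l) \in s2.
      rewrite mem_undup; apply/allpairsP.
      by exists ((t, i), l); rewrite ti mem_enum.
    rewrite !ffunE/=; have := ti; rewrite mem_past => ht.
    have -> : (t == 0%N) = false by lia.
    rewrite !(obs_addb obs) (hX (t%:Z, site i l)) ?(hxi (t%:Z, site i l))//.
    by rewrite mem_cat tl orbT.
- by move=> x y; exact: channel_ge0.
- exact: sum_channel.
- by move=> x x'; exact: channelK.
Qed.

Lemma inverse_mass_ge0 : 0 <= inverse_mass.
Proof. by apply: sumr_ge0 => x _; apply: sumr_ge0. Qed.

(** Replacing [A] by the window event costs the term with 4; moving the visible part of [Y] into the
    conditioning costs the factor 2; passing from the block of [Y] to the pair of blocks costs
    [inverse_mass]. *)
Lemma event_dep j m (v : int) (A : set Omega) (Q : pred {ffun 'I_(N.*2.+1) -> bool}) :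
  measurable A ->
  cond_dep Pr (fun o => `[< A o >]) (vec Z (initial m))
    (fun o => (seen v (block N j.+1 Y o), vec Z (past j m) o)) <=
  2 * inverse_mass *
    cond_dep Pr (Z (j.+1, 0)) (vec Z (initial m)) (vec Z (past j m)) +
  4 * pr Pr [set o | `[< A o >] != Q (block N j.+1 X o)].
Proof.
move=> mA.
have mXY : frv (fun o => (block N j.+1 X o, block N j.+1 Y o)) by exact: frv_pair.
have mQ : frv (Q \o block N j.+1 X) by exact: frv_comp.
have mseen : frv (seen v \o block N j.+1 Y) by exact: frv_comp.
have mW : frv (fun o => (seen v (block N j.+1 Y o), vec Z (past j m) o)).
  exact: frv_pair.
have mV : frv (vec Z (initial m)) by exact: frv_vecZ.
have mP : frv (vec Z (past j m)) by exact: frv_vecZ.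
apply: le_trans (cond_dep_perturb Pr (frv_pred mA) mQ mV mW) _.
rewrite lerD2r.
apply: le_trans (cond_dep_chain Pr mQ mseen mV mP) _.
rewrite -mulrA ler_wpM2l//; apply: le_trans (signal_dep j m).
exact: (@cond_dep_comp _ _ _ _ _ _ _ (fun o => (block N j.+1 X o, block N j.+1 Y o))
  _ _ mXY mV mP _ (fun t => (Q t.1, seen v t.2))).
Qed.

End dependence.

Theorem theorem4p5 (d : measure_display) (Omega : measurableType d)
    (R : realType) (Pr : probability Omega R)
    (Ploc : int -> config -> probability spin R)
    (P : R.-pker config ~> config) (p : R)
    (X Y xi : int -> int -> {RV Pr >-> spin})
    (hmodel : model Ploc P p X Y xi)
    (hti : translation_invariant Ploc X Y)
    (hp : p != 2^-1)
    (A : set config) (mA : measurable A) (v : int)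
    (f g : nat -> Omega -> R)
    (hf : forall k : nat,
       cond_prob Pr (sigma_gen (initial_vars X `|` obs_vars Y k%:Z v))
         [set o | A (fun w => X k%:Z w o)] (f k))
    (hg : forall k : nat,
       cond_prob Pr (sigma_gen (obs_vars Y k%:Z v))
         [set o | A (fun w => X k%:Z w o)] (g k)) :
  ('E_Pr[(fun o => `|f k o - g k o|)%R] @[k --> \oo] --> 0)%E.
Proof.
have [_ _ _ _ _ p01 obs noise_law noise_indep noise_signal] := hmodel.
have [_ shift_inv] := hti.
have mAk k : measurable [set o | A (fun w => X k w o)].
  by apply: (measurable_field _ mA) => w B mB; exact: (frv_RV (X k w) B).
have ifg k : intg Pr (fun o => `|f k o - g k o|).
  by apply: intg_abs; apply: intgB; [have [_ + _] := hf k|have [_ + _] := hg k].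
have EE k : ('E_Pr[(fun o => `|f k o - g k o|)%R])%E = (Ex Pr (fun o => `|f k o - g k o|))%:E.
  rewrite unlock /Ex /Rintegral fineK//.
  exact: (integrable_fin_num measurableT (ifg k)).
under eq_fun do rewrite EE.
apply/fine_cvgP; split; first exact: nearW.
apply/cvgrPdist_le => e e0.
(* Budget: [2 * (e / 16)] for each of the two approximations, [e / 4] for the dependence and
   [4 * (e / 16)] for the window event, below [e] in all. *)
have e16 : 0 < e / 16 by rewrite divr_gt0.
have [M0 HM0] := initial_window_approx shift_inv mA e16.
pose N := maxn M0 `|v|%N.
have [Q hQ] := HM0 N (leq_maxl _ _).
have vN : `|v| <= N%:Z by have := leq_maxr M0 `|v|%N; rewrite -/N; lia.
pose Z := coarse X Y N.
have Cg0 := inverse_mass_ge0 p N; set C := inverse_mass p N in Cg0.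
(* [C] is only known to be nonnegative, hence [C + 1] in the denominator. *)
have eta0 : 0 < e / (8 * (C + 1)).
  by rewrite divr_gt0// mulr_gt0// ltr_wpDl.
have [J HJ] := initial_dependence_vanishes (@frv_coarse _ _ _ _ X Y N)
  (law_coarse_shift shift_inv (N := N)) eta0.
(* The time of the theorem is [j.+1]; the bound [J.+1] excludes time 0. *)
exists J.+1 => // -[//|j] /= jJ; have [M1 HM1] := HJ j jJ.
pose k := (j.+1)%:Z.
pose V m := vec Z (initial m).
pose W m o := (seen v (block N k Y o), vec Z (past j m) o).
have mV m : frv (V m) by apply: frv_vec => x _; exact: frv_coarse.
have mW m : frv (W m).
  apply: frv_pair; last by apply: frv_vec => x _; exact: frv_coarse.
  by apply: (@frv_comp _ _ _ _ (@seen N v) (block N k Y)); apply: frv_ffun => l; exact: frv_RV.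
have frvH h : (initial_vars X `|` obs_vars Y k v) h -> frv h.
  by move=> [|]; [exact: initial_vars_frv|exact: obs_vars_frv].
have resG h : obs_vars Y k v h -> exists M, forall m, (M <= m)%N ->
    forall o o', W m o = W m o' -> h o = h o' by exact: obs_resolved.
have resH h : (initial_vars X `|` obs_vars Y k v) h -> exists M, forall m, (M <= m)%N ->
    forall o o', (V m o, W m o) = (V m o', W m o') -> h o = h o'.
  move=> [hI|/resG[M HM]]; last first.
    by exists M => m /HM hm o o' e'; apply: hm; exact: (congr1 snd e').
  have [M HM] := initial_resolved Y N hI.
  by exists M => m /HM hm o o' e'; apply: hm; exact: (congr1 fst e').
have [M2 HM2] := approx_cond_prob (fun m => frv_pair (mV m) (mW m))
  (gen_measurable frvH) (resolvedP Pr resH) (mAk k) (hf j.+1) e16.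
have [M3 HM3] := approx_cond_prob mW
  (gen_measurable (@obs_vars_frv _ _ _ _ _ _ _)) (resolvedP Pr resG) (mAk k) (hg j.+1) e16.
(* The window comes last, because [M1], [M2] and [M3] depend on the time. *)
pose m := maxn M1 (maxn M2 M3).
have h1 := HM1 m (leq_maxl _ _).
have [c hc] := HM2 m (leq_trans (leq_maxl _ _) (leq_maxr _ _)).
have [c' hc'] := HM3 m (leq_trans (leq_maxr _ _) (leq_maxr _ _)).
have subF : obs_vars Y k v `<=` initial_vars X `|` obs_vars Y k v by right.
have HVW t : sigma_gen (initial_vars X `|` obs_vars Y k v)
    ((fun o => (V m o, W m o)) @^-1` [set t]).
  have sub0 : initial_vars X `<=` initial_vars X `|` obs_vars Y k v by left.
  exact: (frv_pair (initial_frv Y (m := m) sub0) (obs_frv X vN (m := m) subF) [set t]).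
have GW t : sigma_gen (obs_vars Y k v) (W m @^-1` [set t]).
  exact: (obs_frv X vN (m := m) (fun _ => id) [set t]).
have h2 := cond_prob_dist (mAk k) (hf j.+1) (hg j.+1) c c' (mV m) (mW m) HVW GW.
have h3 := event_dep p01 hp noise_law noise_indep noise_signal obs j m v Q (mAk k).
have h4 : 2 * C * cond_dep Pr (Z (j.+1, 0)) (V m) (vec Z (past j m)) <= e / 4.
  apply: (@le_trans _ _ (2 * C * (e / (8 * (C + 1))))).
    by rewrite ler_wpM2l// mulr_ge0.
  have -> : 2 * C * (e / (8 * (C + 1))) = e / 4 * (C / (C + 1)).
    by field; rewrite gt_eqF// ltr_wpDl.
  apply: ler_piMr; first by rewrite divr_ge0// ltW.
  by rewrite ler_pdivrMr ?ltr_wpDl// mul1r lerDl.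
have h5 := hQ k.
rewrite sub0r normrN ger0_norm; last first.
  by rewrite -[0](Ex_cst Pr) /=; apply: le_Ex => //; exact: intg_cst.
apply: le_trans h2 _.
apply: (@le_trans _ _ (2 * (e / 16) + 2 * (e / 16) + (e / 4 + 4 * (e / 16)))).
  apply: lerD; first by apply: lerD; rewrite ler_wpM2l.
  apply: le_trans h3 _; apply: lerD; first exact: h4.
  by rewrite ler_wpM2l.
by move: e0; lra.
Qed.
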